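(* Let $B>0$, $\epsilon>0$, $K\ge 2$, and $\mu=(\mu_1,\dots,\mu_K)\in\mathcal L^K$. Suppose the arms are sampled according to the algorithm $\mathrm{KL_{inf}}$-UCB. Then for every $x\ge0$ and every arm $b\in\{1,\dots,K\}$, $$\mathbb P\Big(\exists n\in\mathbb N:\ N_b(n)\,\mathrm{KL_{inf}}(\hat\mu_b(n),m(\mu_b))-1-2\log(1+N_b(n))\ge x\Big)\le e^{-x}.$$
   Context: For a probability measure $\eta$ on $\mathbb R$, $m(\eta)=\int x\,d\eta(x)$, and $\mathrm{KL}(\eta,\kappa)=\int\log\frac{d\eta}{d\kappa}\,d\eta$. $\mathcal L=\mathcal L_B=\{\eta\in\mathcal P(\mathbb R):\mathbb E_\eta|X|^{1+\epsilon}\le B\}$, and for $\eta\in\mathcal P(\mathbb R)$, $x\in\mathbb R$, $\mathrm{KL_{inf}}(\eta,x)=\inf\{\mathrm{KL}(\eta,\kappa):\kappa\in\mathcal L,\ m(\kappa)\ge x\}$ (with $\inf\emptyset=+\infty$). Bandit model: there are $K$ arms; pulling arm $b$ yields an independent sample from $\mu_b$. $N_b(n)$ is the number of samples drawn from arm $b$ up to time $n$ and $\hat\mu_b(n)$ is the empirical distribution of these $N_b(n)$ samples (times $n$ considered are those with $N_b(n)\ge1$). Algorithm $\mathrm{KL_{inf}}$-UCB (with batch factor $\tilde\eta\ge0$ and threshold functions $g_a$): first pull each of the $K$ arms once and set $n=K+1$. Then repeat: at the current time $n$, compute for each arm the index $U_a(n)=\sup\{x\in\mathbb R: N_a(n)\,\mathrm{KL_{inf}}(\hat\mu_a(n),x)\le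 g_a(n)\}$; let $A_n\in\arg\max_a U_a(n)$ (ties broken arbitrarily); pull arm $A_n$ for a batch of $\max\{1,\lceil\tilde\eta N_{A_n}(n)\rceil\}$ consecutive trials; increase $n$ by the batch size. *)

(* Defs.v *)
From mathcomp Require Import all_boot all_order all_algebra.
From mathcomp Require Import all_classical all_reals all_analysis.

Set Implicit Arguments.
Unset Strict Implicit.
Unset Printing Implicit Defensive.

Import Order.TTheory GRing.Theory Num.Theory.
Import numFieldNormedType.Exports.

Local Open Scope classical_set_scope.
Local Open Scope ring_scope.
Local Open Scope ereal_scope.
Local Open Scope charge_scope.

Notation borel_probability R := (probability (measurableTypeR R) R).

(* Junk value 0 if the identity is not integrable; it is always integrable for
   the elements of [moment_class] below, the exponent being larger than 1. *)
Definition mean (R : realType) (eta : borel_probability R) : R :=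
  (\int[eta]_y y)%R.

(* KL(eta, kappa) = \int log (d eta / d kappa) d eta, with the usual value +oo
   when eta is not absolutely continuous with respect to kappa. *)
Definition KL (R : realType) (eta kappa : borel_probability R) : \bar R :=
  if `[< eta `<< kappa >] then
    \int[eta]_y lne (('d (charge_of_finite_measure eta) '/d kappa) y)
  else +oo.

Definition moment_class (R : realType) (B eps : R) :
    set (borel_probability R) :=
  [set eta : borel_probability R |
     \int[eta]_y (`|y| `^ (1 + eps))%:E <= B%:E].

(* The infimum of the empty set is +oo. *)
Definition KLinf (R : realType) (B eps : R) (eta : borel_probability R)
    (x : R) : \bar R :=
  ereal_inf [set KL eta kappa | kappa in
    [set kappa | moment_class B eps kappa /\ (x <= mean kappa)%R]].

(* Uniform distribution on the entries of [s], with multiplicity; the value for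
   the empty sequence (the Dirac mass at 0) is irrelevant. *)
Definition empirical (R : realType) (s : seq R) : borel_probability R :=
  mnormalize
    (msum (fun i => \d_(nth 0%R s i : measurableTypeR R)) (size s))
    (\d_(0%R : measurableTypeR R)).

Lemma empiricalE (R : realType) (s : seq R) (C : set (measurableTypeR R)) :
  (0 < size s)%N ->
  empirical s C = (((count (fun y => `[< C y >]) s)%:R / (size s)%:R)%R)%:E.
Proof.
move=> s0.
have sumE (D : set (measurableTypeR R)) :
    msum (fun i => \d_(nth 0%R s i : measurableTypeR R)) (size s) D
    = (count (fun y => `[< D y >]) s)%:R%:E :> \bar R.
  rewrite /msum -[in RHS]sum1_count natr_sum [in RHS](big_nth 0%R) big_mkord.
  rewrite [in RHS]big_mkcond/= -sumEFin; apply: eq_bigr => i _.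
  rewrite diracE; case: asboolP => [/mem_set ->//|nD].
  by rewrite memNset.
have normE (m : {measure set (measurableTypeR R) -> \bar R})
    (Q : borel_probability R) : m setT = (size s)%:R%:E ->
    mnormalize m Q C = m C * ((size s)%:R^-1)%:E.
  by rewrite /mnormalize => ->; rewrite eqe pnatr_eq0 gtn_eqF.
rewrite [LHS]normE; first by rewrite [X in X * _]sumE -EFinM.
rewrite [LHS]sumE; congr (_%:R%:E).
by rewrite -count_predT; apply: eq_count => y; apply/asboolP.
Qed.

(* Trials are numbered 1, 2, 3, ...; in trial t the arm [A t w] is pulled and
   the reward [Y t w] is observed ([A 0] and [Y 0] are never used).  At time n
   the trials 1, ..., n - 1 have been carried out, in accordance with the time
   being n = K + 1 after the K initial pulls. *)
Definition samples (R : realType) (Omega : Type) (K : nat)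
    (A : nat -> Omega -> 'I_K) (Y : nat -> Omega -> R)
    (b : 'I_K) (n : nat) (w : Omega) : seq R :=
  [seq Y t w | t <- index_iota 1 n & A t w == b].

Definition pulls (Omega : Type) (K : nat) (A : nat -> Omega -> 'I_K)
    (b : 'I_K) (n : nat) (w : Omega) : nat :=
  count (fun t => A t w == b) (index_iota 1 n).

(* [F t] is the information available after trial t (possibly including
   external randomness).  The arm of trial t + 1 is chosen from [F t] and,
   conditionally on [F t] and on arm a being chosen, the reward of trial t + 1
   has law [mu a]; this conditional law is written out over the events
   of [F t]. *)
Record bandit_model (d : measure_display) (Omega : measurableType d)
    (R : realType) (P : probability Omega R) (K : nat)
    (mu : 'I_K -> borel_probability R) (F : nat -> set (set Omega))
    (A : nat -> Omega -> 'I_K) (Y : nat -> Omega -> R) : Prop := {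
  history_sigma_algebra : forall t, sigma_algebra setT (F t) ;
  history_measurable : forall t, F t `<=` measurable ;
  history_nondecreasing : forall s t, (s <= t)%N -> F s `<=` F t ;
  arm_predictable : forall t a, F t (A t.+1 @^-1` [set a]) ;
  reward_adapted : forall t (C : set (measurableTypeR R)), measurable C ->
    F t.+1 (Y t.+1 @^-1` C) ;
  reward_law : forall t a (G : set Omega) (C : set (measurableTypeR R)),
    F t G -> measurable C ->
    P (G `&` A t.+1 @^-1` [set a] `&` Y t.+1 @^-1` C)
    = P (G `&` A t.+1 @^-1` [set a]) * mu a C
}.

Definition klucb_index (R : realType) (B eps : R) (Omega : Type) (K : nat)
    (g : 'I_K -> nat -> Omega -> R)
    (A : nat -> Omega -> 'I_K) (Y : nat -> Omega -> R)
    (a : 'I_K) (n : nat) (w : Omega) : \bar R :=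
  ereal_sup [set x%:E | x in
    [set x : R | (pulls A a n w)%:R%:E
                   * KLinf B eps (empirical (samples A Y a n w)) x
                 <= (g a n w)%:E]].

Definition batch_size (R : realType) (etat : R) (Omega : Type) (K : nat)
    (A : nat -> Omega -> 'I_K) (n : nat) (w : Omega) : nat :=
  maxn 1 `|Num.ceil (etat * (pulls A (A n w) n w)%:R)%R|%N.

(* The times at which the batches begin. *)
Fixpoint batch_time (R : realType) (etat : R) (Omega : Type) (K : nat)
    (A : nat -> Omega -> 'I_K) (w : Omega) (j : nat) : nat :=
  if j is j'.+1 then
    (batch_time etat A w j' + batch_size etat A (batch_time etat A w j') w)%N
  else K.+1.

(* The order of the initial pulls and the tie-breaking rule are unspecified.
   The thresholds may be random: in applications g a n depends on the number of
   pulls of arm a. *)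
Record klucb_run (R : realType) (B eps etat : R) (Omega : Type) (K : nat)
    (g : 'I_K -> nat -> Omega -> R)
    (A : nat -> Omega -> 'I_K) (Y : nat -> Omega -> R) : Prop := {
  initial_pulls : forall w a, pulls A a K.+1 w = 1%N ;
  batch_arm_maximal : forall w j a,
    let n := batch_time etat A w j in
    klucb_index B eps g A Y a n w <= klucb_index B eps g A Y (A n w) n w ;
  batch_arm_constant : forall w j t,
    (batch_time etat A w j <= t < batch_time etat A w j.+1)%N ->
    A t w = A (batch_time etat A w j) w
}.

(* Main.v *)
From HB Require Import structures.
Require Import Defs.
From mathcomp Require Import all_boot all_order all_algebra.
From mathcomp Require Import all_classical all_reals all_analysis.
From mathcomp Require Import measurable_realfun ring lra.

(* Write p = 1 + eps, x = m(mu_b), and for l = (l1, l2) >= 0 put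
   h_l(y) = 1 - l1 (y - x) - l2 (B - |y|^p); let Lam be the convex set of the l
   for which h_l is nonnegative.  By convex duality, if x < B^(1/p) then for the
   empirical distribution of y_1, ..., y_N,
     N KLinf = max_{l in Lam} sum_i log h_l(y_i).
   Every l in Lam is a bet with conditional mean at most 1 under mu_b, so the
   wealth prod_i h_l(y_i) is a nonnegative supermartingale, and so is its average
   over Lam with respect to the Lebesgue measure.  If l* is the maximizer, the
   points (1 - t) l* + t l of the copy of Lam shrunk towards l* by t = 1/(N+1) have
   wealth at least (1 - t)^N times the maximal one, and this copy has the fraction
   t^2 of the area of Lam; hence the average wealth is at least
   exp(N KLinf - 1 - 2 log(1+N)), and Ville's maximal inequality concludes.  If
   x = B^(1/p), the only feasible law is a Dirac mass and almost surely there is no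
   deviation at all.  Strong duality is also what makes the event measurable: the
   maximum over Lam is a supremum over its rational points. *)

Set Implicit Arguments.
Unset Strict Implicit.
Unset Printing Implicit Defensive.

Import Order.TTheory GRing.Theory Num.Theory.
Import numFieldNormedType.Exports.

Local Open Scope classical_set_scope.
Local Open Scope ring_scope.

(** * Tangent inequalities for real powers *)

Section real_powers.
Context {R : realType}.
Implicit Types p u z y : R.

(** Young's inequality for the product of [y] and [z ^ (p - 1)], with conjugate exponents [p] and
    [p / (p - 1)], multiplied by [p]. *)
Lemma powR_tangent_nneg p z y : 1 < p -> 0 <= z -> 0 <= y ->
  z `^ p + p * z `^ (p - 1) * (y - z) <= y `^ p.
Proof.
move=> p1 z0 y0.
have p0 : 0 < p by exact: lt_trans p1.
have q0 : 0 < p / (p - 1) by rewrite divr_gt0// subr_gt0.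
have p'0 : p - 1 != 0 by rewrite subr_eq0 gt_eqF.
have H : y * z `^ (p - 1) <=
    y `^ p / p + (z `^ (p - 1)) `^ (p / (p - 1)) / (p / (p - 1)).
  apply: conjugate_powR => //; first exact: powR_ge0.
  by field; rewrite p'0 gt_eqF.
move: H; rewrite -powRrM mulrCA mulfV ?mulr1// -(ler_pM2l p0).
have -> : p * (y `^ p / p + z `^ p / (p / (p - 1))) = y `^ p + (p - 1) * z `^ p.
  by field; rewrite p'0 gt_eqF.
rewrite -(mulr_powRB1 z0 p0); clear.
by move: (z `^ (p - 1)) (y `^ p) => w W; lra.
Qed.

(** The slope at [z] is nonnegative, so replacing [|y|] by [y] only lowers the tangent. *)
Lemma powR_tangent p z y : 1 < p -> 0 <= z ->
  z `^ p + p * z `^ (p - 1) * (y - z) <= `|y| `^ p.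
Proof.
move=> p1 z0; apply: le_trans (powR_tangent_nneg p1 z0 (normr_ge0 y)).
rewrite lerD2l ler_wpM2l ?lerD2r ?ler_norm// mulr_ge0 ?powR_ge0//.
by rewrite ltW// (lt_trans _ p1).
Qed.

Lemma bernoulli_powR p u : 1 < p -> 0 <= u -> 1 + p * (u - 1) <= u `^ p.
Proof.
move=> p1 u0; have := @powR_tangent p 1 u p1 ler01.
by rewrite !powR1 mulr1 ger0_norm.
Qed.

(* Squaring the weak inequality at [Num.sqrt u] makes it strict. *)
Lemma bernoulli_powR_lt p u : 1 < p -> 0 <= u -> u != 1 ->
  1 + p * (u - 1) < u `^ p.
Proof.
move=> p1 u0 u1.
pose v := Num.sqrt u.
have v0 : 0 <= v by exact: sqrtr_ge0.
have uE : u = v * v by rewrite -expr2 sqr_sqrtr.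
have v1 : v != 1 by apply: contra u1 => /eqP v1; rewrite uE v1 mulr1.
have := bernoulli_powR p1 v0; rewrite uE powRM//.
have : 0 <= v `^ p by exact: powR_ge0.
have : 0 < (v - 1) ^+ 2 by rewrite exprn_even_gt0//= subr_eq0.
move: (v `^ p) => w.
have [h|h] := leP 0 (1 + p * (v - 1)).
  move=> s w0 /[dup] h1; rewrite -(subr_ge0 _ w) => h2.
  have : (1 + p * (v - 1)) * (1 + p * (v - 1)) <= w * w by exact: ler_pM.
  have : 0 < p * (p - 1) * (v - 1) ^+ 2 by apply: mulr_gt0 => //; apply: mulr_gt0; lra.
  clear; move=> *; lra.
(* Here the lower bound at [v] is negative and cannot be squared; but then [v < 1], and the tangent
   at [v * v] is even lower, whereas [w * w] is nonnegative. *)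
move=> s w0 _; have : 1 + p * (v * v - 1) <= 1 + p * (v - 1) by nra.
by nra.
Qed.

(** For [y >= 0], homogeneity reduces this to the strict Bernoulli inequality at [y / z]. For
    [y < 0], strictness comes from the positive slope between [y] and [|y|]. *)
Lemma powR_tangent_lt p z y : 1 < p -> 0 < z -> y != z ->
  z `^ p + p * z `^ (p - 1) * (y - z) < `|y| `^ p.
Proof.
move=> p1 z0 yz; have p0 : 0 < p by exact: lt_trans p1.
have zp0 : 0 < z `^ p by exact: powR_gt0.
have zE := mulr_powRB1 (ltW z0) p0.
have zp1 : 0 < z `^ (p - 1) by exact: powR_gt0.
have [y0|y0] := leP 0 y; last first.
  have := @powR_tangent p z `|y| p1 (ltW z0); rewrite normr_id ltr0_norm//.
  have : p * z `^ (p - 1) * (y - z) < p * z `^ (p - 1) * (- y - z).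
    by rewrite ltr_pM2l ?mulr_gt0//; lra.
  lra.
have := @bernoulli_powR_lt p (y / z) p1.
rewrite divr_ge0// ?ltW// -subr_eq0.
have -> : y / z - 1 = (y - z) / z by field; rewrite gt_eqF.
rewrite mulf_neq0 ?invr_eq0 ?subr_eq0 ?(gt_eqF z0)// => /(_ isT isT).
rewrite powRM ?invr_ge0 ?(ltW z0)// -(ltr_pM2l zp0) => h.
rewrite ger0_norm//; move: h.
have -> : z `^ p * (y `^ p * z^-1 `^ p) = y `^ p * ((z * z^-1) `^ p).
  by rewrite powRM ?invr_ge0 ?(ltW z0)//; ring.
rewrite mulfV ?gt_eqF// powR1 mulr1.
suff -> : z `^ p * (1 + p * ((y - z) / z)) = z `^ p + p * z `^ (p - 1) * (y - z) by [].
by rewrite -zE; field; rewrite gt_eqF.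
Qed.

Lemma continuous_norm_powR p y : y != 0 -> {for y, continuous (fun y => `|y| `^ p)}.
Proof.
move=> y0; suff : {for y, continuous ((fun v : R => v `^ p) \o (fun v : R => `|v| : R))} by [].
apply: continuous_comp; first exact: norm_continuous.
apply: differentiable_continuous; apply/derivable1_diffP.
by apply: derivable_powR; rewrite in_itv/= normr_gt0 y0.
Qed.

End real_powers.

(** * The convex region of dual parameters *)

Section dual_region.
Context {R : realType} (p B x : R).
Implicit Types (l : R * R) (t y z : R).

Definition dual_fun l y := 1 - l.1 * (y - x) - l.2 * (B - `|y| `^ p).

Definition dual_region : set (R * R) :=
  [set l | [/\ 0 <= l.1, 0 <= l.2 & forall y, 0 <= dual_fun l y]].

(** The weight [t] is that of [l'], so that [barycenter t l] is the homothety of centre [l] and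
    ratio [t]. *)
Definition barycenter t l l' : R * R :=
  ((1 - t) * l.1 + t * l'.1, (1 - t) * l.2 + t * l'.2).

Lemma dual_fun_barycenter t l l' y :
  dual_fun (barycenter t l l') y = (1 - t) * dual_fun l y + t * dual_fun l' y.
Proof. by rewrite /dual_fun /=; ring. Qed.

Lemma dual_region_convex t l l' : 0 <= t <= 1 ->
  dual_region l -> dual_region l' -> dual_region (barycenter t l l').
Proof.
move=> /andP[t0 t1] [a1 a2 a3] [b1 b2 b3].
have t1' : 0 <= 1 - t by rewrite subr_ge0.
split; rewrite ?addr_ge0 ?mulr_ge0// => y.
by rewrite dual_fun_barycenter addr_ge0 ?mulr_ge0.
Qed.

Lemma dual_region0 : dual_region (0, 0).
Proof. by split => //= y; rewrite /dual_fun/= !mul0r !subr0. Qed.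

(** Slater's condition: the Dirac mass at [s] satisfies both constraints strictly. It is what bounds
    the dual region. *)
Lemma exists_slater : 1 < p -> 0 < B -> x < B `^ p^-1 -> exists2 s, x < s & `|s| `^ p < B.
Proof.
move=> p1 B0 xB; pose r := B `^ p^-1.
have p0 : 0 < p by exact: lt_trans p1.
have r0 : 0 < r by exact: powR_gt0.
have rB : r `^ p = B by rewrite -powRrM mulVf ?gt_eqF// powRr1// ltW.
(* The maximum with 0 makes the midpoint nonnegative, so that its absolute value stays below [r]
   even for very negative [x]. *)
exists ((Num.max x 0 + r) / 2).
  have : x <= Num.max x 0 by rewrite le_max lexx.
  rewrite -/r in xB; lra.
have : 0 <= Num.max x 0 by rewrite le_max lexx orbT.
have : Num.max x 0 < r by rewrite gt_max xB.
move: (Num.max x 0) => X h1 h2; have q0 : 0 <= (X + r) / 2 by lra.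
rewrite ger0_norm// -rB; apply: gt0_ltr_powR; rewrite ?nnegrE//.
  exact: ltW.
by clear rB; lra.
Qed.

(* Positivity on the rectangle follows from |y|^p >= 1 + p (|y| - 1). *)
Lemma dual_region_rectangle : 1 < p -> 0 < B -> exists2 r : R, 0 < r &
  forall l, 0 <= l.1 <= r -> r <= l.2 <= 2 * r -> dual_region l.
Proof.
move=> p1 B0.
have [X X0 xX] : exists2 X : R, 0 <= X & - X <= x.
  by exists `|x|; rewrite // lerNl -normrN ler_norm.
have [r r0 rE] : exists2 r : R, 0 < r & r * (1 + X + 2 * (B + p)) = 1.
  exists (1 + X + 2 * (B + p))^-1; first by rewrite invr_gt0; lra.
  by rewrite mulVf ?gt_eqF//; lra.
exists r => // -[a c]/= /andP[a0 ar] /andP[rc cr].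
split => //=; first by apply: le_trans rc; exact: ltW.
move=> y; rewrite /dual_fun/=.
have [Y [Y0 yY YE]] : exists Y : R, [/\ 0 <= Y, y <= Y & `|y| `^ p = Y `^ p].
  by exists `|y|; rewrite normr_ge0 ler_norm.
rewrite YE; have := bernoulli_powR p1 Y0; move: (Y `^ p) => W h.
have h1 : a * y <= a * Y by rewrite ler_wpM2l.
have h2 : a * - X <= a * x by rewrite ler_wpM2l.
have h3 : a * X <= r * X by rewrite ler_wpM2r.
(* This is why [l.2] is kept above [r]: since [a <= r <= c], the growth of the moment term pays for
   the linear term. The remaining constants are absorbed by the choice of [r]. *)
have h4 : a * Y <= c * p * Y by rewrite ler_wpM2r//; nra.
have h5 : c * (1 + p * (Y - 1)) <= c * W by rewrite ler_wpM2l//; lra.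
have h6 : c * (B + p) <= 2 * r * (B + p) by rewrite ler_wpM2r//; lra.
nra.
Qed.

(** At a Slater point [s], nonnegativity reads [l.1 * (s - x) + l.2 * (B - |s| ^ p) <= 1], where
    both coefficients are positive. *)
Lemma dual_region_bounded : 1 < p -> 0 < B -> x < B `^ p^-1 -> exists2 M : R, 0 < M &
  forall l, dual_region l -> l.1 <= M /\ l.2 <= M.
Proof.
move=> p1 B0 /(exists_slater p1 B0)[s xs sB].
exists ((s - x)^-1 + (B - `|s| `^ p)^-1).
  by rewrite addr_gt0// invr_gt0 subr_gt0.
move=> l [l1 l2 /(_ s)]; rewrite /dual_fun.
have : 0 < s - x by rewrite subr_gt0.
have : 0 < B - `|s| `^ p by rewrite subr_gt0.
move: (_ - _ `^ _) (s - x) => u v u0 v0 h.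
have u' : 0 < u^-1 by rewrite invr_gt0.
have v' : 0 < v^-1 by rewrite invr_gt0.
have e1 : u * u^-1 = 1 by rewrite mulfV ?gt_eqF.
have e2 : v * v^-1 = 1 by rewrite mulfV ?gt_eqF.
have h1 : l.1 * v <= 1 by nra.
have h2 : l.2 * u <= 1 by nra.
split.
  suff : l.1 <= v^-1 by lra.
  by rewrite -[leLHS]mulr1 -e2 mulrA -[leRHS]mul1r ler_wpM2r// ltW.
suff : l.2 <= u^-1 by lra.
by rewrite -[leLHS]mulr1 -e1 mulrA -[leRHS]mul1r ler_wpM2r// ltW.
Qed.

End dual_region.

(** * The wealth of a bet and its maximizer *)

Section wealth.
Context {R : realType} (p B x : R).
Implicit Types (l : R * R) (s : seq R) (t y z : R).
Local Notation h := (dual_fun p B x).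
Local Notation Lam := (dual_region p B x).

Definition wealth l s := \prod_(y <- s) h l y.

Lemma wealth_ge0 l s : Lam l -> 0 <= wealth l s.
Proof. by move=> [_ _ l0]; exact: prodr_ge0. Qed.

Lemma wealth0 s : wealth (0, 0) s = 1.
Proof. by rewrite /wealth big1// => y _; rewrite /dual_fun/= !mul0r !subr0. Qed.

(** The dual function is affine in [l]; dropping the nonnegative share of [l'] leaves the factor
    [1 - t] for each observation. *)
Lemma wealth_barycenter t l l' s : 0 <= t <= 1 -> Lam l -> Lam l' ->
  (1 - t) ^+ size s * wealth l s <= wealth (barycenter t l l') s.
Proof.
move=> /andP[t0 t1] Ll Ll'; rewrite /wealth; elim: s => [|y s ih].
  by rewrite !big_nil mulr1.
have [_ _ hl] := Ll; have [_ _ hl'] := Ll'.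
rewrite !big_cons/= exprS mulrACA; apply: ler_pM => //.
- by rewrite mulr_ge0// subr_ge0.
- by rewrite mulr_ge0 ?exprn_ge0 ?subr_ge0//; exact: (wealth_ge0 s Ll).
- by rewrite dual_fun_barycenter lerDl mulr_ge0.
Qed.

Lemma continuous_dual_fun y : continuous (fun l => h l y).
Proof.
move=> l; rewrite /dual_fun; apply: cvgB; first apply: cvgB.
- exact: cvg_cst.
- by apply: cvgMr_tmp; exact: cvg_fst.
- by apply: cvgMr_tmp; exact: cvg_snd.
Qed.

Lemma continuous_wealth s : continuous (fun l => wealth l s).
Proof.
elim: s => [|y s ih] l.
  rewrite (_ : (fun l => _) = cst 1); first exact: cst_continuous.
  by apply/funext => l'; rewrite /wealth big_nil.
rewrite (_ : (fun l => _) = (fun l => h l y * wealth l s)); last first.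
  by apply/funext => l'; rewrite /wealth big_cons.
by apply: cvgM; [exact: continuous_dual_fun|exact: ih].
Qed.

Lemma closed_dual_region : closed Lam.
Proof.
have -> : Lam = ((fst @^-1` [set a | 0 <= a]) `&` (snd @^-1` [set a | 0 <= a])) `&`
    \bigcap_y ((h ^~ y) @^-1` [set a | 0 <= a]).
  apply/seteqP; split => [l [a b c]|l [[a b] c]].
    by split => // y _; exact: c.
  by split => // y; exact: (c y I).
apply: closedI; first apply: closedI.
- by apply: preimage_closed; [by move=> l _; exact: cvg_fst|exact: closed_ge].
- by apply: preimage_closed; [by move=> l _; exact: cvg_snd|exact: closed_ge].
- apply: closed_bigI => y _.
  by apply: preimage_closed; [by move=> l _; exact: continuous_dual_fun|exact: closed_ge].
Qed.

Lemma compact_dual_region : 1 < p -> 0 < B -> x < B `^ p^-1 -> compact Lam.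
Proof.
move=> p1 B0 xB; have [M M0 LM] := dual_region_bounded p1 B0 xB.
apply: (@subclosed_compact _ _ (`[0, M] `*` `[0, M])).
- exact: closed_dual_region.
- by apply: compact_setX; exact: segment_compact.
- move=> l Ll; have [l1 l2] := LM _ Ll; case: Ll => ? ? _.
  by split; rewrite /= in_itv/=; apply/andP.
Qed.

Lemma wealth_argmax s : 1 < p -> 0 < B -> x < B `^ p^-1 ->
  exists2 l, Lam l & forall l', Lam l' -> wealth l' s <= wealth l s.
Proof.
move=> p1 B0 xB.
have [||l Ll lmax] := @compact_EVT_max _ R (wealth ^~ s) Lam _
    (compact_dual_region p1 B0 xB).
- by exists (0, 0); exact: dual_region0.
- by apply: continuous_subspaceT; exact: continuous_wealth.
exists l; first by rewrite inE in Ll.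
by move=> l' Ll'; apply: lmax; rewrite inE.
Qed.

(** An explicit quadratic remainder, which takes the place of differentiating the wealth along a
    segment. *)
Lemma prodrD1_first_order (u : seq R) : exists2 C : R, 0 <= C &
  forall t, 0 <= t <= 1 ->
  `|\prod_(i <- u) (1 + t * i) - (1 + t * \sum_(i <- u) i)| <= C * t ^+ 2.
Proof.
elim: u => [|v u [C C0 ih]].
  by exists 0 => // t _; rewrite !big_nil mulr0 addr0 subrr normr0 mul0r.
exists ((1 + `|v|) * C + `|v * \sum_(i <- u) i|) => [|t t01].
  by rewrite addr_ge0 ?mulr_ge0 ?addr_ge0.
have {ih} := ih t t01; rewrite !big_cons; move: (\sum_(i <- u) i) (\prod_(i <- u) _).
move=> S P ih; have {t01}/andP[t0 t1] := t01.
rewrite (_ : _ - _ = (1 + t * v) * (P - (1 + t * S)) + t ^+ 2 * (v * S)); last by ring.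
rewrite (le_trans (ler_normD _ _))// [leRHS]mulrDl; apply: lerD; last first.
  by rewrite normrM ger0_norm ?sqr_ge0// mulrC.
rewrite normrM -mulrA; apply: ler_pM => //.
rewrite (le_trans (ler_normD _ _))// normr1 lerD2l normrM ger0_norm//.
by rewrite ler_piMl.
Qed.

(** The sum is the right derivative at [t = 0] of a product that is equal to 1 there and never
    exceeds 1. *)
Lemma sum_le0_of_prod_le1 (u : seq R) :
  (forall t, 0 <= t <= 1 -> \prod_(i <- u) (1 + t * i) <= 1) ->
  \sum_(i <- u) i <= 0.
Proof.
move=> u1; have [C C0 uC] := prodrD1_first_order u.
rewrite leNgt; apply/negP => S0.
move: u1 uC S0; move: (\sum_(i <- u) i) => S u1 uC S0.
(* For such a small [t] the first-order gain [t * S] exceeds the remainder [C * t ^ 2]. *)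
pose t := Num.min 1 (S / (C + 1)).
have C1 : 0 < C + 1 by lra.
have t0 : 0 < t by rewrite lt_min ltr01 divr_gt0.
have t1 : t <= 1 by rewrite ge_min lexx.
have tS : t * (C + 1) <= S by rewrite -ler_pdivlMr// ge_min lexx orbT.
have t01 : 0 <= t <= 1 by rewrite t1 ltW.
have := u1 t t01; have := uC t t01; rewrite ler_norml => /andP[+ _].
move: (\prod_(i <- u) _) => P h1 h2.
have : t * S <= t * (C * t) by move: h1 h2; rewrite expr2; nra.
rewrite ler_pM2l// => h3; nra.
Qed.

(** First-order optimality condition: along the segment from [l] to [l'], the wealth relative to
    that of [l] is the product of the factors [1 + t * (h l' y / h l y - 1)], which is at most 1. *)
Lemma wealth_argmax_numeraire l s : Lam l ->
  (forall l', Lam l' -> wealth l' s <= wealth l s) -> forall l', Lam l' ->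
  \sum_(y <- s) h l' y / h l y <= (size s)%:R.
Proof.
move=> Ll lmax l' Ll'.
have W0 : 0 < wealth l s.
  apply: lt_le_trans (lmax _ (dual_region0 _ _ _)); by rewrite wealth0.
have hl y : y \in s -> h l y != 0.
  by move=> ys; move: (gt_eqF W0) => /negbT; rewrite prodf_seq_neq0 => /allP/(_ y ys).
rewrite -subr_le0.
have -> : \sum_(y <- s) h l' y / h l y - (size s)%:R =
    \sum_(i <- [seq h l' y / h l y - 1 | y <- s]) i.
  by rewrite big_map sumrB big_const_seq count_predT iter_addr_0.
apply: sum_le0_of_prod_le1 => t t01.
rewrite -(ler_pM2r W0) mul1r big_map -big_split/=.
apply: le_trans (lmax _ (dual_region_convex t01 Ll Ll')).
rewrite /wealth !big_seq le_eqVlt; apply/orP; left; apply/eqP.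
apply: eq_bigr => y ys; rewrite dual_fun_barycenter; field; exact: hl.
Qed.

(** The rectangle contained in the region, shrunk towards [l], still has nonempty interior, so it
    contains a rational point, even if [l] is on the boundary. *)
Lemma dual_region_rational_dense l t s : 1 < p -> 0 < B -> Lam l -> 0 < t <= 1 ->
  exists q : rat * rat, Lam (ratr q.1, ratr q.2) /\
    (1 - t) ^+ size s * wealth l s <= wealth (ratr q.1, ratr q.2) s.
Proof.
move=> p1 B0 Ll /andP[t0 t1]; have [r r0 rect] := dual_region_rectangle x p1 B0.
have [q1] := @rat_in_itvoo R ((1 - t) * l.1) ((1 - t) * l.1 + t * r) ltac:(nra).
have [q2] := @rat_in_itvoo R ((1 - t) * l.2 + t * r) ((1 - t) * l.2 + t * (2 * r)) ltac:(nra).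
rewrite !in_itv/= => /andP[a1 a2] /andP[a3 a4].
(* The preimage of the rational point under the homothety of centre [l] and ratio [t]; it falls into
   the rectangle. *)
pose l' : R * R := ((ratr q1 - (1 - t) * l.1) / t, (ratr q2 - (1 - t) * l.2) / t).
have Ll' : Lam l'.
  by apply: rect; rewrite /l'/= ?ler_pdivrMr ?ler_pdivlMr ?mul0r//; apply/andP; split; lra.
exists (q1, q2) => /=.
have -> : (ratr q1, ratr q2) = barycenter t l l'.
  by rewrite /barycenter/l'/=; congr pair; field; rewrite gt_eqF.
have t01 : 0 <= t <= 1 by rewrite t1 ltW.
by split; [exact: dual_region_convex|exact: wealth_barycenter].
Qed.

Lemma measurable_dual_fun_comp d (T : measurableType d) (f g Y : T -> R) :
  measurable_fun setT f -> measurable_fun setT g -> measurable_fun setT Y ->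
  measurable_fun setT (fun w => h (f w, g w) (Y w)).
Proof.
move=> mf mg mY; rewrite /dual_fun/=.
have mYp : measurable_fun setT (fun w => `|Y w| `^ p).
  have mn : measurable_fun setT (fun w => `|Y w|) by exact: measurableT_comp.
  exact: (measurableT_comp (measurable_powR p) mn).
by repeat (apply: measurable_funB || apply: measurable_funM || by []).
Qed.

Lemma measurable_dual_fun (l : R * R) : measurable_fun [set: R] (h l).
Proof.
by case: l => a b; apply: (@measurable_dual_fun_comp _ _ (cst a) (cst b) id).
Qed.

(** By continuity in [y], countably many constraints suffice. Continuity is used away from 0 only,
    hence the separate constraint at [y = 0]. *)
Lemma measurable_dual_region : measurable (Lam : set (measurableTypeR R * measurableTypeR R)).
Proof.
have -> : Lam = ((fst @^-1` `[0, +oo[%classic) `&` (snd @^-1` `[0, +oo[%classic)) `&`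
    \bigcap_q ((h ^~ (ratr q)) @^-1` `[0, +oo[%classic) `&` ((h ^~ 0) @^-1` `[0, +oo[%classic).
  apply/seteqP; split => [l [a b c]|l [[[/= a b] c] c0]].
    by split; [split; [split|]|] => [||q _|]; rewrite /= in_itv/= andbT.
  move: a b; rewrite !in_itv/= !andbT => a b; split => // y.
  have [->|y0] := eqVneq y 0; first by move: c0; rewrite /= in_itv/= andbT.
  rewrite leNgt; apply/negP => hy0.
  have cy : {for y, continuous (h l)}.
    rewrite /dual_fun; apply: cvgB; first apply: cvgB.
    - exact: cvg_cst.
    - by apply: cvgMl_tmp; apply: cvgB; [exact: cvg_id|exact: cvg_cst].
    - apply: cvgMl_tmp; apply: cvgB; [exact: cvg_cst|exact: continuous_norm_powR].
  have : \forall z \near y, h l z < 0.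
    exact: (cvgr_lt _ cy).
  move=> /nbhs_ballP[e e0 he].
  have [q] := @rat_in_itvoo R (y - e) (y + e) ltac:(move: e0 => /=; lra).
  rewrite in_itv/= => /andP[q1 q2].
  have := c q I; rewrite /= in_itv/= andbT leNgt he//=.
  by rewrite /ball/= ltr_norml; apply/andP; split; lra.
have m0 : measurable (`[0, +oo[%classic : set (measurableTypeR R)) by [].
have mh y : measurable ((h ^~ y) @^-1` `[0, +oo[%classic :
    set (measurableTypeR R * measurableTypeR R)).
  rewrite -[X in measurable X]setTI.
  have := @measurable_dual_fun_comp _ (measurableTypeR R * measurableTypeR R)%type fst snd (cst y).
  move=> /(_ measurable_fst measurable_snd (measurable_cst _)); apply => //.
apply: measurableI => //; apply: measurableI; first apply: measurableI.
- by rewrite -[X in measurable X]setTI; exact: measurable_fst.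
- by rewrite -[X in measurable X]setTI; exact: measurable_snd.
- rewrite -[X in measurable X]setCK setC_bigcap; apply: measurableC.
  apply: bigcupT_measurable_rat => q; exact: measurableC.
Qed.

End wealth.

(** * Pushforwards with their measure structure *)

Section pushforward_measure.
Context d d' (T1 : measurableType d) (T2 : measurableType d') (R : realType).

(** The measurability proof is an argument, so that the structures of measure and finite measure can
    be inferred from the term. *)
Definition pushforward_measure (m : set T1 -> \bar R) (f : T1 -> T2)
  (mf : measurable_fun setT f) : set T2 -> \bar R := pushforward m f.

HB.instance Definition _ (m : {measure set T1 -> \bar R}) (f : T1 -> T2)
    (mf : measurable_fun setT f) :=
  Measure.copy (pushforward_measure m mf)
    (@measure_function_pushforward__canonical__measure_function_Measure _ _ _ _ _ m f mf).

Fact fin_num_pushforward_measure (m : {finite_measure set T1 -> \bar R})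
    (f : T1 -> T2) (mf : measurable_fun setT f) :
  fin_num_fun (pushforward_measure m mf).
Proof.
move=> C mC; apply: fin_num_measure.
by rewrite -[X in measurable X]setTI; exact: mf.
Qed.

HB.instance Definition _ (m : {finite_measure set T1 -> \bar R})
    (f : T1 -> T2) (mf : measurable_fun setT f) :=
  Measure_isFinite.Build _ _ _ (pushforward_measure m mf)
    (fin_num_pushforward_measure m mf).

End pushforward_measure.

(** * Area in the plane and its behaviour under homotheties *)

Section area.
Context {R : realType}.
Local Open Scope ereal_scope.
Local Notation leb :=
  (@lebesgue_measure R : {sigma_finite_measure set (measurableTypeR R) -> \bar R}).
Local Notation RR := (measurableTypeR R * measurableTypeR R)%type.

Definition area : set RR -> \bar R := leb \x leb.

HB.instance Definition _ := Measure.on area.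

Lemma area_setX (C D : set (measurableTypeR R)) : measurable C -> measurable D ->
  area (C `*` D) = leb C * leb D.
Proof. exact: product_measure1E. Qed.

(* The sigma-finite instance of the library on products is shadowed by the one
   for products of subprobabilities. *)
Fact area_sigma_finite : sigma_finite setT area.
Proof.
exists (fun n => `[(- n%:R)%R, n%:R] `*` `[(- n%:R)%R, n%:R]).
  apply/esym; rewrite -subTset => l _; pose n := (Num.bound `|l.1| + Num.bound `|l.2|)%N.
  have nE (u : R) m : (Num.bound `|u| <= m)%N -> (- m%:R <= u <= m%:R)%R.
    move=> um; rewrite -ler_norml; apply: le_trans (ltW (archi_boundP _)) _ => //.
    by rewrite ler_nat.
  by exists n => //; split; rewrite /= in_itv/= nE// ?leq_addr ?leq_addl.
move=> n; split; first exact: measurableX.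
by rewrite area_setX//= !lebesgue_measure_itv/= lte_mul_pinfty//;
  case: ifPn => // _; rewrite -EFinB ?ltry ?lee_fin//; lra.
Qed.

HB.instance Definition _ := Measure_isSigmaFinite.Build _ _ _ area area_sigma_finite.

(** The inverse of the map [t * u + d], so that a preimage under it is a copy scaled by [t]. *)
Definition homothety (t d u : R) : R := ((u - d) / t)%R.

Lemma measurable_homothety t d :
  measurable_fun setT (homothety t d : measurableTypeR R -> measurableTypeR R).
Proof. by rewrite /homothety; apply: measurable_funM => //; apply: measurable_funB. Qed.

(** Uniqueness of Lebesgue measure: [t^-1] times the pushforward gives half-open intervals their
    length. *)
Lemma lebesgue_homothety t d (A : set (measurableTypeR R)) : (0 < t)%R ->
  measurable A -> leb (homothety t d @^-1` A) = t%:E * leb A.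
Proof.
move=> t0 mA.
have t'0 : (0 <= t^-1)%R by rewrite invr_ge0 ltW.
pose m := mscale (NngNum t'0) (pushforward_measure leb (measurable_homothety t d)).
have mE C : m C = (t^-1)%:E * leb (homothety t d @^-1` C) by [].
have : leb A = m A.
  apply: lebesgue_measure_unique => // _ [[a b] ab <-].
  apply: etrans (esym (mE _)) => /=.
  have -> : homothety t d @^-1` [set` `]a, b]] = [set` `](a * t + d)%R, (b * t + d)%R]].
    apply/seteqP; split => u /=; rewrite !in_itv/= /homothety ltr_pdivlMr// ler_pdivrMr//;
      by rewrite ltrBrDr lerBlDr.
  rewrite !lebesgue_measure_itv/= !lte_fin ltrD2r ltr_pM2r//.
  case: ifPn => _; last by rewrite mule0.
  by rewrite -!EFinB -EFinM; congr EFin; field; rewrite gt_eqF.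
rewrite mE => ->; rewrite muleA -EFinM mulfV ?gt_eqF// mul1e//.
Qed.

(** Uniqueness of the product measure, the formula being checked on rectangles. *)
Lemma area_homothety t d1 d2 (A : set RR) : (0 < t)%R -> measurable A ->
  area ((fun l => (homothety t d1 l.1, homothety t d2 l.2)) @^-1` A) =
  (t ^+ 2)%:E * area A.
Proof.
move=> t0 mA.
have t'0 : (0 <= (t ^+ 2)^-1)%R by rewrite invr_ge0 ltW// exprn_gt0.
pose f (l : RR) : RR := (homothety t d1 l.1, homothety t d2 l.2).
have mf : measurable_fun setT f.
  by apply/measurable_fun_pairP; split;
    apply: (measurableT_comp (measurable_homothety _ _)).
pose m := mscale (NngNum t'0) (pushforward_measure area mf).
have mE C : m C = ((t ^+ 2)^-1)%:E * area (f @^-1` C) by [].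
have -> : area A = m A.
  apply: product_measure_unique => // C D mC mD; apply: etrans (mE _) _.
  have -> : f @^-1` (C `*` D) = (homothety t d1 @^-1` C) `*` (homothety t d2 @^-1` D) by [].
  have mh u (E : set (measurableTypeR R)) : measurable E ->
      measurable (homothety t u @^-1` E : set (measurableTypeR R)).
    by move=> mE'; rewrite -[X in measurable X]setTI; exact: measurable_homothety.
  rewrite area_setX; [|exact: mh|exact: mh].
  rewrite !lebesgue_homothety// muleACA -EFinM -expr2 [LHS]muleA -EFinM.
  by rewrite mulVf ?mul1e// gt_eqF// exprn_gt0.
by rewrite mE muleA -EFinM mulfV ?mul1e// gt_eqF// exprn_gt0.
Qed.

End area.

(** * The average wealth over the dual region *)

Section mixture.
Context {R : realType} (p B x : R).
Local Open Scope ereal_scope.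
Local Notation RR := (measurableTypeR R * measurableTypeR R)%type.
Local Notation Lam := (dual_region p B x).
Local Notation wealth := (wealth p B x).

Lemma area_dual_region_gt0 : (1 < p)%R -> (0 < B)%R -> 0 < area Lam.
Proof.
move=> p1 B0; have [r r0 rect] := dual_region_rectangle x p1 B0.
have -> // : 0 < area (`[0%R, r] `*` `[r, (2 * r)%R]) -> 0 < area Lam.
  move=> h; apply: (lt_le_trans h); apply: le_measure.
  - by rewrite inE; apply: measurableX.
  - by rewrite inE; exact: measurable_dual_region.
  - by move=> l [/= l1 l2]; apply: rect; move: l1 l2; rewrite !in_itv.
rewrite area_setX//= !lebesgue_measure_itv/= !lte_fin r0.
have -> : (r < 2 * r)%R by lra.
by rewrite -!EFinB -EFinM lte_fin mulr_gt0//; lra.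
Qed.

Lemma area_dual_region_lty : (1 < p)%R -> (0 < B)%R -> (x < B `^ p^-1)%R ->
  area Lam < +oo.
Proof.
move=> p1 B0 xB; have [M M0 LM] := dual_region_bounded p1 B0 xB.
apply: (@le_lt_trans _ _ (area (`[0%R, M] `*` `[0%R, M]))).
  apply: le_measure.
  - by rewrite inE; exact: measurable_dual_region.
  - by rewrite inE; apply: measurableX.
  - move=> l Ll; have [l1 l2] := LM _ Ll; case: Ll => ? ? _.
    by split; rewrite /= in_itv/=; apply/andP.
rewrite area_setX//= !lebesgue_measure_itv/= !lte_fin M0.
by rewrite -!EFinB -EFinM ltry.
Qed.

Lemma measurable_wealth (s : seq R) : measurable_fun setT (wealth^~ s : RR -> R).
Proof.
apply: measurable_prod => y _.
rewrite (_ : (fun l : RR => _) = (fun l => dual_fun p B x (l.1, l.2) (cst y l))).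
  exact: measurable_dual_fun_comp.
by apply/funext => -[].
Qed.

Lemma integral_wealth_ge_homothety (l : R * R) (t : R) (s : seq R) :
  (0 < t <= 1)%R -> Lam l ->
  ((1 - t) ^+ size s * t ^+ 2 * wealth l s)%:E * area Lam <=
  \int[area]_(l' in Lam) (wealth l' s)%:E.
Proof.
move=> /andP[t0 t1] Ll.
(* The copy of [Lam] shrunk towards [l] by the factor [t], written as a preimage under the inverse
   homothety; convexity keeps it inside [Lam]. *)
pose A : set RR :=
  (fun l' => (homothety t ((1 - t) * l.1) l'.1, homothety t ((1 - t) * l.2) l'.2)) @^-1` Lam.
have mL := measurable_dual_region p B x.
have t01 : (0 <= t <= 1)%R by rewrite t1 ltW.
have AE l' : A l' -> Lam l' /\ ((1 - t) ^+ size s * wealth l s <= wealth l' s)%R.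
  rewrite /A/= => Al'.
  have -> : l' = barycenter t l
      (homothety t ((1 - t) * l.1) l'.1, homothety t ((1 - t) * l.2) l'.2).
    by case: l' {Al'} => a b; rewrite /barycenter/homothety/=; congr pair; field; rewrite gt_eqF.
  by split; [exact: dual_region_convex|exact: wealth_barycenter].
have mA : measurable A.
  rewrite -[X in measurable X]setTI; apply: measurable_fun_pair => //;
    exact: (measurableT_comp (measurable_homothety _ _)).
have mw : measurable_fun setT (fun l' : RR => (wealth l' s)%:E).
  by apply/measurable_EFinP; exact: measurable_wealth.
apply: (@le_trans _ _ (\int[area]_(l' in A) (wealth l' s)%:E)); last first.
  apply: ge0_subset_integral => //.
  - exact: measurable_funTS.
  - by move=> l' Ll'; rewrite lee_fin wealth_ge0.
  - by move=> l' /AE[].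
have -> : ((1 - t) ^+ size s * t ^+ 2 * wealth l s)%:E * area Lam =
    ((1 - t) ^+ size s * wealth l s)%:E * area A.
  by rewrite area_homothety// muleA -EFinM; congr (_%:E * _); ring.
rewrite -integral_cst//; apply: ge0_le_integral => //.
- by move=> l' _; rewrite lee_fin mulr_ge0 ?wealth_ge0// exprn_ge0// subr_ge0.
- exact: measurable_funTS.
- by move=> l' /AE[_]; rewrite lee_fin.
Qed.

(* The shrinking factor is [t = 1 / (n + 1)], for which [(1 - t) ^+ n >= 1 / e]. *)
Lemma integral_wealth_ge (l : R * R) (s : seq R) : (0 < size s)%N -> Lam l ->
  (wealth l s * expR (-1) * ((1 + (size s)%:R) ^+ 2)^-1)%:E * area Lam <=
  \int[area]_(l' in Lam) (wealth l' s)%:E.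
Proof.
move=> s0 Ll; pose n := size s; pose t : R := ((1 + n%:R)^-1)%R.
have n0 : (0 < n%:R :> R)%R by rewrite ltr0n.
have n1 : (0 < 1 + n%:R :> R)%R by rewrite addr_gt0.
have t01 : (0 < t <= 1)%R by rewrite invr_gt0 n1 invf_le1// lerDl ltW.
apply: le_trans (integral_wealth_ge_homothety s t01 Ll).
apply: lee_wpmul2r; first exact: measure_ge0.
rewrite lee_fin -mulrA mulrC; apply: ler_wpM2r; first exact: wealth_ge0.
rewrite -exprVn; apply: ler_wpM2r; first by rewrite exprn_ge0// invr_ge0 ltW.
(* In this form the bound follows from [1 + 1 / n <= exp (1 / n)], raised to the power [n]. *)
have -> : (1 - t = (1 + n%:R^-1)^-1)%R.
  by rewrite /t; field; rewrite !gt_eqF//= addr_gt0.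
rewrite expRN exprVn lef_pV2 ?posrE ?expR_gt0 ?exprn_gt0 ?addr_gt0 ?invr_gt0//.
rewrite -[X in (_ <= expR X)%R](@mulfV _ n%:R) ?gt_eqF// mulrC expRM_natr.
by apply: lerXn2r; rewrite ?nnegrE ?addr_ge0 ?invr_ge0 ?expR_ge0// expR_ge1Dx.
Qed.

End mixture.

(** * Finitely supported measures and empirical distributions *)

Section discrete_measures.
Context {R : realType}.
Implicit Types (c : seq ({nonneg R} * R)) (s : seq R).
Local Notation atom0 := (0%:nng : {nonneg R}, 0 : R).
Definition uniform_weight s : {nonneg R} := ((size s)%:R^-1)%:nng.

Local Open Scope ereal_scope.

(** Locations may repeat, and their weights then add up, so a sample becomes a list of atoms without
    removing duplicates. *)
Definition discrete c : {measure set (measurableTypeR R) -> \bar R} :=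
  msum (fun i => mscale (nth atom0 c i).1
    \d_((nth atom0 c i).2 : measurableTypeR R)) (size c).

Lemma discreteE c (C : set (measurableTypeR R)) :
  discrete c C = (\sum_(a <- c) a.1%:num * \1_C a.2)%R%:E.
Proof.
rewrite /discrete/= /msum (big_nth atom0) big_mkord -sumEFin.
by apply: eq_bigr => i _; rewrite EFinM.
Qed.

Lemma ge0_integral_discrete c (f : R -> \bar R) (g : R -> R) :
  measurable_fun setT f -> (forall y, 0 <= f y) ->
  (forall a, a \in c -> f a.2 = (g a.2)%:E) ->
  \int[discrete c]_y f y = (\sum_(a <- c) a.1%:num * g a.2)%R%:E.
Proof.
move=> mf f0 fg; rewrite /discrete ge0_integral_measure_sum//.
rewrite (big_nth atom0) big_mkord -sumEFin; apply: eq_bigr => i _.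
by rewrite ge0_integral_mscale// integral_dirac// diracT mul1e fg ?mem_nth// EFinM.
Qed.

Lemma integral_discrete c (f : R -> \bar R) (g : R -> R) :
  measurable_fun setT f ->
  (forall a, a \in c -> f a.2 = (g a.2)%:E) ->
  \int[discrete c]_y f y = (\sum_(a <- c) a.1%:num * g a.2)%R%:E.
Proof.
move=> mf fg; rewrite integralE.
rewrite (@ge0_integral_discrete _ _ (fun y => Num.max (g y) 0)%R); last 3 first.
- exact: measurable_funepos.
- by move=> y; exact: funepos_ge0.
- by move=> a /fg; rewrite funeposE => ->; rewrite EFin_max.
rewrite (@ge0_integral_discrete _ _ (fun y => Num.max (- g y) 0)%R); last 3 first.
- exact: measurable_funeneg.
- by move=> y; exact: funeneg_ge0.
- by move=> a /fg; rewrite funenegE => ->; rewrite EFin_max.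
rewrite -EFinB -sumrB; congr EFin; apply: eq_bigr => a _.
rewrite -mulrBr; congr *%R; rewrite /Num.max.
by case: ifPn; case: ifPn; lra.
Qed.

(** Normalization supplies the structure of a probability; as the total mass is 1, it divides by
    1. *)
Lemma exists_discrete_probability c : (\sum_(a <- c) a.1%:num = 1)%R ->
  exists kappa : borel_probability R,
    forall C, measurable C -> kappa C = discrete c C.
Proof.
move=> c1; exists (mnormalize (discrete c) \d_(0%R : measurableTypeR R)) => C mC.
have cT : discrete c setT = 1.
  by rewrite discreteE; under eq_bigr do rewrite indicT mulr1; rewrite c1.
have normE (m : {measure set (measurableTypeR R) -> \bar R}) (Q : borel_probability R) :
    m setT = 1 -> mnormalize m Q C = m C * ((1 : R)^-1)%:E.
  by rewrite /mnormalize => ->; rewrite eqe oner_eq0.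
by rewrite [LHS]normE// invr1 mule1.
Qed.

Lemma empirical_discrete s : (0 < size s)%N -> forall C, measurable C ->
  empirical s C = discrete [seq (uniform_weight s, y) | y <- s] C.
Proof.
move=> s0 C mC; rewrite empiricalE// discreteE big_map; congr EFin.
rewrite -mulr_sumr mulrC; congr (_ * _)%R.
elim: s {s0} => [|y s ih]/=; first by rewrite big_nil.
by rewrite big_cons natrD ih indicE; congr (_%:R + _)%R; congr nat_of_bool;
  apply/asboolP/idP => [/mem_set|/set_mem].
Qed.

Lemma integral_empirical s (f : R -> \bar R) (g : R -> R) : (0 < size s)%N ->
  measurable_fun setT f -> (forall y, y \in s -> f y = (g y)%:E) ->
  \int[empirical s]_y f y = ((size s)%:R^-1 * \sum_(y <- s) g y)%R%:E.
Proof.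
move=> s0 mf fg.
rewrite (eq_measure_integral (discrete [seq (uniform_weight s, y) | y <- s])); last first.
  by move=> C mC _; exact: empirical_discrete.
rewrite (integral_discrete (g := g))//; last by move=> _ /mapP[y ys ->]; exact: fg.
by rewrite big_map mulr_sumr.
Qed.

Lemma empirical_set1 s y : (0 < size s)%N ->
  empirical s [set y] = ((count_mem y s)%:R / (size s)%:R)%R%:E.
Proof.
move=> s0; rewrite empiricalE//; congr ((_%:R / _)%R%:E).
by apply: eq_count => z /=; apply/asboolP/eqP.
Qed.

End discrete_measures.

(** * Relative entropy of an empirical distribution *)

Section KL_empirical.
Context {R : realType}.
Implicit Types (s : seq R) (kappa : borel_probability R).
Local Open Scope ereal_scope.

Lemma measurable_lne_EFin d (T : measurableType d) (g : T -> R) :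
  measurable_fun setT g -> measurable_fun setT (fun y => lne (g y)%:E).
Proof.
move=> mg.
rewrite (_ : (fun y => _) = (fun y => if (g y <= 0)%R then -oo else (ln (g y))%:E)).
  apply: measurable_fun_ifT => //; first exact: measurable_fun_ler.
  by apply/measurable_EFinP; exact: measurableT_comp.
apply/funext => y; case: ifPn => [y0|]; first by rewrite le0_lneNy.
by rewrite -ltNge => y0; rewrite lne_EFin.
Qed.

Lemma empirical_dominates_set1 s kappa y : empirical s `<< kappa -> y \in s ->
  (0 < fine (kappa [set y]))%R.
Proof.
move=> /null_content_dominatesP sk ys.
have s0 : (0 < size s)%N by case: s ys {sk}.
rewrite lt_neqAle fine_ge0// andbT eq_sym; apply/eqP => k0.
have /sk : kappa [set y] = 0 by rewrite -[LHS]fineK ?fin_num_measure// k0.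
move=> /(_ (measurable_set1 _)); rewrite empirical_set1// => -[].
move=> /eqP; rewrite mulf_eq0 invr_eq0 !pnatr_eq0 => /orP[|]; last by rewrite gtn_eqF.
by rewrite -leqn0 leqNgt -has_count has_pred1 ys.
Qed.

(** Domination gives every sample point positive mass under [kappa]; integrating the density over
    that singleton determines its value there as a ratio of masses. *)
Lemma KL_empirical s kappa : (0 < size s)%N -> empirical s `<< kappa ->
  (size s)%:R%:E * KL (empirical s) kappa =
  (\sum_(y <- s) ln ((count_mem y s)%:R / (size s)%:R / fine (kappa [set y])))%R%:E.
Proof.
move=> s0 sk; rewrite /KL; case: asboolP => // _.
set f := Radon_Nikodym _ _.
have ffin y : f y \is a fin_num by exact: Radon_Nikodym_fin_num.
have mf : measurable_fun setT f.
  by apply: (measurable_int kappa); exact: Radon_Nikodym_integrable.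
have fE : f = (fun y => (fine (f y))%:E) by apply/funext => y; rewrite fineK.
have mlf : measurable_fun setT (fun y => lne (f y)).
  rewrite fE; apply: measurable_lne_EFin; exact: measurableT_comp.
rewrite (@integral_empirical _ _ _ (fun y =>
    ln ((count_mem y s)%:R / (size s)%:R / fine (kappa [set y])))%R)//.
  by rewrite -EFinM mulrA divff ?mul1r// pnatr_eq0 gtn_eqF.
move=> y ys.
have ky := empirical_dominates_set1 sk ys.
have : empirical s [set y] = f y * kappa [set y].
  apply: etrans (@Radon_Nikodym_integral _ _ _ (charge_of_finite_measure (empirical s))
    kappa [set y] sk (measurable_set1 _)) _.
  rewrite (eq_integral (cst (f y))) ?integral_cst//.
  by move=> z; rewrite inE => ->.
rewrite empirical_set1// fE -[kappa _]fineK ?fin_num_measure// -EFinM => -[fk].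
rewrite fE -[fine (f y)](mulfK (lt0r_neq0 ky)) -fk lne_EFin//.
rewrite divr_gt0// divr_gt0 ?ltr0n//.
by rewrite -has_count has_pred1.
Qed.

End KL_empirical.

(** * Completing a deficient measure by one atom *)

Section moment_completion.
Context {R : realType} (p B x : R).
Local Notation Lam := (dual_region p B x).

(** Let [T] be the tangent of the moment function at [z]. Then [c = T(x) - B], which is negative
    because [T(x) <= T(s) <= |s| ^ p < B] at a Slater point [s]. The dual function of the given pair
    is [(|y| ^ p - T(y)) / - c]. *)
Lemma dual_region_tangent (z : R) : 1 < p -> 0 < B -> x < B `^ p^-1 -> 0 <= z ->
  exists c : R, [/\ c < 0, c = z `^ p - B - p * z `^ (p - 1) * (z - x) &
    Lam (p * z `^ (p - 1) / - c, (- c)^-1)].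
Proof.
move=> p1 B0 xB z0; have [s xs sB] := exists_slater p1 B0 xB.
have tan y := powR_tangent y p1 z0.
have : 0 <= p * z `^ (p - 1) by rewrite mulr_ge0 ?powR_ge0// ltW// (lt_trans _ p1).
move: (p * _) tan => u tan u0.
exists (z `^ p - B - u * (z - x)).
have c0 : z `^ p - B - u * (z - x) < 0.
  have := tan s; have : u * x <= u * s by rewrite ler_wpM2l// ltW.
  move: sB; move: (`|s| `^ p) (z `^ p) => S Z; lra.
split => //; split => /=.
- by rewrite divr_ge0// oppr_ge0 ltW.
- by rewrite invr_ge0 oppr_ge0 ltW.
- move=> y; rewrite /dual_fun/=; have := tan y.
  move: c0; move: (`|y| `^ p) => Y; rewrite -oppr_gt0.
  have -> : Y = z `^ p + u * (y - z) + (Y - (z `^ p + u * (y - z))) by ring.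
  rewrite -subr_ge0; move: (Y - _) => e; move: (z `^ p) => Z c0 e0.
  have e0' : 0 <= e by move: e0; rewrite addrAC subrr add0r.
  have -> : 1 - u / - (Z - B - u * (z - x)) * (y - x) -
      (- (Z - B - u * (z - x)))^-1 * (B - (Z + u * (y - z) + e)) =
      e / - (Z - B - u * (z - x)) by field; rewrite -oppr_eq0 gt_eqF.
  by rewrite divr_ge0// ltW.
Qed.

(* A single atom suffices to restore both constraints, by convexity of the
   moment; the tangents of the moment function are the dual certificates. *)
Lemma moment_completion (a b w : R) : 1 < p -> 0 < B -> x < B `^ p^-1 -> 0 <= w ->
  (forall l, Lam l -> - (l.1 * a) - l.2 * b <= w) ->
  exists z : R, 0 <= a + w * (z - x) /\ 0 <= b + w * (B - `|z| `^ p).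
Proof.
move=> p1 B0 xB w0 H.
have p0 : 0 < p by exact: lt_trans p1.
have pn0 : p != 0 by rewrite gt_eqF.
have p'0 : p - 1 != 0 by rewrite subr_eq0 gt_eqF.
(* The hypothesis at the multipliers of the tangent at [z], multiplied by [- c]. *)
have key z : 0 <= z ->
    w * (z `^ p - B - p * z `^ (p - 1) * (z - x)) <= p * z `^ (p - 1) * a + b.
  move=> z0; have [c [c0 <- /H/=]] := dual_region_tangent p1 B0 xB z0.
  move: (p * _) => u; rewrite -oppr_gt0 in c0.
  rewrite -(ler_pM2r c0) mulrBl mulNr [X in - X - _](_ : _ = u * a); last first.
    by field; rewrite -oppr_eq0 gt_eqF.
  rewrite [X in _ - X](_ : _ = b); last by field; rewrite -oppr_eq0 gt_eqF.
  lra.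
move: w0; rewrite le_eqVlt => /predU1P[w0|w0].
  exists 0; rewrite -w0 !mul0r !addr0; rewrite -w0 in key.
  split; last first.
    by have := key 0 (lexx _); rewrite !powR0// mulr0 !mul0r add0r.
  rewrite leNgt; apply/negP => a0.
  (* With no mass left to place, a negative [a] is refuted by a steep tangent: the point used below
     has slope [v], and [v * a + b <= -1]. *)
  pose v := (`|b| + 1) / - a.
  have v0 : 0 <= v by rewrite divr_ge0 ?addr_ge0// oppr_ge0 ltW.
  have := key ((v / p) `^ (p - 1)^-1) (powR_ge0 _ _).
  have vp0 : 0 <= v / p by apply: divr_ge0 => //; exact: ltW.
  rewrite -!powRrM mulVf// powRr1// mul0r.
  have -> : p * (v / p) * a = - (`|b| + 1) by rewrite /v; field; rewrite pn0 lt_eqF.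
  by have := ler_norm b; move: `|b| => nb; lra.
(* The value [x - a / w] makes the mean constraint tight; the maximum with 0 keeps the point where
   the tangents are available. *)
exists (Num.max 0 (x - a / w)).
have z0 : 0 <= Num.max 0 (x - a / w) by rewrite le_max lexx.
have z1 : x - a / w <= Num.max 0 (x - a / w) by rewrite le_max lexx orbT.
have h1 : 0 <= a + w * (Num.max 0 (x - a / w) - x).
  have : w * (x - a / w - x) <= w * (Num.max 0 (x - a / w) - x) by rewrite ler_pM2l// lerD2r.
  rewrite [X in X <= _](_ : _ = - a); last by field; rewrite gt_eqF.
  lra.
split => //; rewrite ger0_norm//.
have := key _ z0.
(* Complementary slackness: either the mean constraint is tight or the slope vanishes at 0. What
   remains of [key] is the moment constraint. *)
have : p * Num.max 0 (x - a / w) `^ (p - 1) * (a + w * (Num.max 0 (x - a / w) - x)) = 0.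
  have [h|h] := leP 0 (x - a / w); last by rewrite powR0// mulr0 mul0r.
  by rewrite [X in _ * X = 0](_ : _ = 0) ?mulr0//; field; rewrite gt_eqF.
move: (Num.max _ _ `^ p) => Z; move: (p * _) => u; move: (Num.max _ _) => z; lra.
Qed.

End moment_completion.

(** * Integrals with respect to laws of the moment class *)

Section feasible_laws.
Context {R : realType} (B eps x : R).
Implicit Types kappa : borel_probability R.
Local Open Scope ereal_scope.
Local Notation p := (1 + eps)%R.

Lemma measurable_norm_powR (q : R) :
  measurable_fun setT (fun y : measurableTypeR R => (`|y| `^ q)%R).
Proof.
have mn : measurable_fun setT (fun y : measurableTypeR R => `|y|%R) by exact: measurableT_comp.
exact: (measurableT_comp (measurable_powR q) mn).
Qed.

Lemma integrable_moment kappa : moment_class B eps kappa ->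
  kappa.-integrable setT (fun y : measurableTypeR R => (`|y| `^ p)%:E).
Proof.
move=> kB; apply/integrableP; split.
  by apply/measurable_EFinP; exact: measurable_norm_powR.
rewrite (eq_integral (fun y : measurableTypeR R => (`|y| `^ p)%:E)); last first.
  by move=> y _; rewrite gee0_abs// lee_fin powR_ge0.
exact: le_lt_trans kB (ltry _).
Qed.

Lemma integrable_id kappa : (0 < eps)%R -> moment_class B eps kappa ->
  kappa.-integrable setT (EFin : R -> \bar R).
Proof.
move=> e0 kB.
have i1 : kappa.-integrable setT (fun y : measurableTypeR R => (1 + `|y| `^ p)%:E).
  have := integrableD measurableT (finite_measure_integrable_cst kappa 1 measurableT)
    (integrable_moment kB).
  by under eq_fun do rewrite -EFinD.
apply: le_integrable i1 => //.
move=> y _; rewrite !abse_EFin lee_fin [leRHS]ger0_norm ?addr_ge0 ?powR_ge0//.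
have p1 : (1 < p)%R by rewrite ltrDl.
have H Y : (0 <= Y -> Y <= 1 + Y `^ p)%R.
  move=> Y0; have := bernoulli_powR p1 Y0; have := powR_ge0 Y p.
  by move: (Y `^ p)%R => W; have [Y1|Y1] := leP Y 1%R; [lra|nra].
exact: H.
Qed.

Lemma integral_affine_moment kappa (a b c : R) : (0 < eps)%R -> moment_class B eps kappa ->
  \int[kappa]_y (a + b * y + c * `|y| `^ p)%:E =
  (a + b * mean kappa + c * fine (\int[kappa]_y (`|y| `^ p)%:E))%:E.
Proof.
move=> e0 kB; have im := integrable_moment kB; have ii := integrable_id e0 kB.
have ia := finite_measure_integrable_cst kappa a measurableT.
have ib := integrableZl measurableT b ii; have ic := integrableZl measurableT c im.
have iab := integrableD measurableT ia ib.
under eq_integral do rewrite !EFinD !EFinM.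
rewrite (integralD measurableT iab ic) (integralD measurableT ia ib).
rewrite (integralZl measurableT im) (integralZl measurableT ii).
have -> : \int[kappa]_y (EFin \o cst a) y = a%:E.
  rewrite (integral_cst kappa measurableT a%:E) -[RHS]mule1; congr (_ * _).
  exact: probability_setT.
rewrite !EFinD !EFinM; congr (_ + _ * _ + _ * _).
- by rewrite /mean/Rintegral fineK//; exact: integrable_fin_num.
- by rewrite fineK//; exact: integrable_fin_num.
Qed.

(** Each nonnegative multiplier penalizes a constraint that [kappa] satisfies. It serves twice: for
    weak duality, and with the law of the arm itself for the supermartingale property. *)
Lemma integral_dual_fun_le1 kappa (l : R * R) : (0 < eps)%R ->
  moment_class B eps kappa -> (x <= mean kappa)%R -> dual_region p B x l ->
  \int[kappa]_y (dual_fun p B x l y)%:E <= 1.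
Proof.
move=> e0 kB xk [l1 l2 _].
rewrite (eq_integral (fun y : measurableTypeR R =>
    ((1 + l.1 * x - l.2 * B) + (- l.1) * y + l.2 * `|y| `^ p)%:E)); last first.
  by move=> y _; congr EFin; rewrite /dual_fun; ring.
rewrite integral_affine_moment// lee_fin.
have : (fine (\int[kappa]_y (`|y| `^ p)%:E) <= B)%R.
  by rewrite -lee_fin fineK//; apply: integrable_fin_num => //; exact: integrable_moment.
move: (fine _) (mean _) xk => M m xm MB; nra.
Qed.

(* The integrand minus its tangent at [B `^ p^-1] has integral at most 0. *)
Lemma boundary_law_dirac kappa : (0 < eps)%R -> (0 < B)%R -> (B `^ p^-1 <= x)%R ->
  moment_class B eps kappa -> (x <= mean kappa)%R ->
  kappa (~` [set (B `^ p^-1)%R]) = 0.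
Proof.
move=> e0 B0 Bx kB xk; pose r := (B `^ p^-1)%R.
have p1 : (1 < p)%R by rewrite ltrDl.
have p0 : (0 < p)%R by exact: lt_trans p1.
have r0 : (0 < r)%R by exact: powR_gt0.
have rB : (r `^ p = B)%R by rewrite -powRrM mulVf ?gt_eqF// powRr1// ltW.
pose u := (p * r `^ (p - 1))%R.
have u0 : (0 <= u)%R by rewrite mulr_ge0 ?powR_ge0// ltW.
pose phi (y : R) := ((- B + u * r) + (- u) * y + 1 * `|y| `^ p)%R.
have phiE y : phi y = (`|y| `^ p - (r `^ p + p * r `^ (p - 1) * (y - r)))%R.
  by rewrite /phi rB /u; ring.
have phi0 y : (0 <= phi y)%R by rewrite phiE subr_ge0 powR_tangent// ltW.
have mphi : measurable_fun setT (fun y : measurableTypeR R => (phi y)%:E : \bar R).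
  apply/measurable_EFinP; apply: measurable_funD; last first.
    by apply: measurable_funM => //; exact: measurable_norm_powR.
  by apply: measurable_funD => //; exact: measurable_funM.
have I0 : \int[kappa]_y (phi y)%:E = 0.
  apply/eqP; rewrite eq_le integral_ge0 ?andbT; last by move=> y _; rewrite lee_fin.
  rewrite integral_affine_moment// lee_fin.
  have : (fine (\int[kappa]_y (`|y| `^ p)%:E) <= B)%R.
    by rewrite -lee_fin fineK//; apply: integrable_fin_num => //; exact: integrable_moment.
  have : (u * r <= u * mean kappa)%R by rewrite ler_wpM2l// (le_trans Bx).
  move: (fine _) (mean _) => M m; lra.
have /(ae_eq_integral_abs kappa measurableT mphi)[N [mN N0 phiN]] :
    \int[kappa]_y `|(phi y)%:E| = 0.
  by rewrite -[RHS]I0; apply: eq_integral => y _; rewrite gee0_abs// lee_fin.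
apply/eqP; rewrite eq_le measure_ge0 andbT -N0; apply: le_measure.
- by rewrite inE; apply: measurableC; exact: measurable_set1.
- by rewrite inE.
- move=> y /= yr; apply: phiN => /= /(_ I) [].
  apply/eqP; rewrite gt_eqF// phiE subr_gt0 powR_tangent_lt//; exact/eqP.
Qed.

End feasible_laws.

(** * Convex duality for [KLinf] *)

Section duality.
Context {R : realType} (B eps x : R).
Implicit Types (kappa : borel_probability R) (l : R * R) (s : seq R).
Local Open Scope ereal_scope.
Local Notation p := (1 + eps)%R.
Local Notation Lam := (dual_region p B x).
Local Notation h := (dual_fun p B x).
Local Notation wealth := (wealth p B x).

Lemma ln_prod s (f : R -> R) : (forall y, y \in s -> (0 < f y)%R) ->
  (ln (\prod_(y <- s) f y) = \sum_(y <- s) ln (f y))%R.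
Proof.
elim: s => [|y s ih] f0; first by rewrite !big_nil ln1.
rewrite !big_cons lnM ?posrE ?ih//; first by move=> z zs; apply: f0; rewrite inE zs orbT.
- by apply: f0; rewrite mem_head.
- by rewrite big_seq; apply: prodr_gt0 => z zs; apply: f0; rewrite inE zs orbT.
Qed.

(** Passes from the sample with repetitions to its distinct values, over which atoms can be summed
    below an integral. *)
Lemma sum_div_count_mem s (f : R -> R) :
  (\sum_(y <- s) f y / (count_mem y s)%:R = \sum_(y <- undup s) f y)%R.
Proof.
rewrite -[LHS]big_undup_iterop_count big_seq [RHS]big_seq; apply: eq_bigr => y ys.
apply: (@etrans _ _ ((f y / (count_mem y s)%:R) *+ count_mem y s)%R) => //.
rewrite -mulr_natr divfK// pnatr_eq0 -lt0n.
by rewrite -has_count has_pred1 -mem_undup.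
Qed.

Lemma sum_atoms_le_integral kappa (f : R -> R) s : uniq s ->
  measurable_fun setT f -> (forall y, (0 <= f y)%R) ->
  (\sum_(y <- s) f y * fine (kappa [set y]))%:E <= \int[kappa]_y (f y)%:E.
Proof.
move=> us mf f0.
have mEf : measurable_fun setT (fun y : measurableTypeR R => (f y)%:E) by exact/measurable_EFinP.
apply: (@le_trans _ _ (\int[kappa]_(y in \big[setU/set0]_(i <- s) [set i]) (f y)%:E)); last first.
  apply: ge0_subset_integral => //.
  - by apply: bigsetU_measurable => i _; exact: measurable_set1.
  - by move=> y _; rewrite lee_fin.
rewrite ge0_integral_bigsetU//; last 3 first.
- by apply/trivIsetP => i j _ _ ij; rewrite -subset0 => y [/= -> ] /eqP; rewrite (negbTE ij).
- exact: measurable_funTS.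
- by move=> y _; rewrite lee_fin.
rewrite -sumEFin; apply: lee_sum => y _; rewrite EFinM.
rewrite (eq_integral (cst (f y)%:E)); last by move=> z; rewrite inE => ->.
rewrite (integral_cst kappa (measurable_set1 y) (f y)%:E) fineK ?fin_num_measure//.
Qed.

(** Weak duality. With [r] the density of the empirical law, [ln v <= v - 1] at [v = h l y / r y]
    leaves the sum of these ratios to be bounded by [size s]. That sum is [size s] times a sum over
    atoms of [kappa], itself at most the integral of the bet. *)
Lemma ln_wealth_le_KL s kappa l : (0 < size s)%N -> (0 < eps)%R ->
  moment_class B eps kappa -> (x <= mean kappa)%R ->
  Lam l -> (0 < wealth l s)%R ->
  (ln (wealth l s))%:E <= (size s)%:R%:E * KL (empirical s) kappa.
Proof.
move=> s0 e0 kB xk Ll W0.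
have [sk|nsk] := pselect (empirical s `<< kappa); last first.
  rewrite /KL; case: asboolP => // _.
  by rewrite gt0_muley ?leey// lte_fin ltr0n.
have N0 : (0 < (size s)%:R :> R)%R by rewrite ltr0n.
have [_ _ h0] := Ll.
have hy y : y \in s -> (0 < h l y)%R.
  move=> ys; rewrite lt_neqAle h0 andbT eq_sym.
  by move: (lt0r_neq0 W0); rewrite prodf_seq_neq0 => /allP/(_ _ ys).
rewrite KL_empirical// lee_fin /wealth ln_prod//.
pose r y := ((count_mem y s)%:R / (size s)%:R / fine (kappa [set y]))%R.
have r0 y : y \in s -> (0 < r y)%R.
  move=> ys; rewrite divr_gt0// ?divr_gt0 ?(empirical_dominates_set1 sk)//.
  by rewrite ltr0n -has_count has_pred1.
suff H : (\sum_(y <- s) h l y / r y <= (size s)%:R)%R.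
  rewrite -subr_le0 -sumrB -(subr_le0 (size s)%:R) in H *.
  apply: le_trans H.
  have -> : (\sum_(y <- s) h l y / r y - (size s)%:R = \sum_(y <- s) (h l y / r y - 1))%R.
    by rewrite sumrB big_const_seq count_predT iter_addr_0.
  rewrite big_seq [leRHS]big_seq; apply: ler_sum => y ys.
  rewrite -ln_div ?posrE ?hy ?r0//.
  have hr : (0 < h l y / r y)%R by rewrite divr_gt0 ?hy ?r0.
  rewrite -{1}[(h l y / r y)%R](subrK 1%R) addrC; apply: le_ln1Dx.
  by rewrite ltrBrDr addrC subrr.
have -> : (\sum_(y <- s) h l y / r y =
    (size s)%:R * \sum_(y <- undup s) h l y * fine (kappa [set y]))%R.
  rewrite -sum_div_count_mem mulr_sumr big_seq [RHS]big_seq; apply: eq_bigr => y ys.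
  have k0 := empirical_dominates_set1 sk ys.
  have c0 : (0 < (count_mem y s)%:R :> R)%R by rewrite ltr0n -has_count has_pred1.
  by rewrite /r; field; rewrite !gt_eqF.
rewrite -[leRHS]mulr1 ler_wpM2l ?(ltW N0)// -lee_fin.
apply: le_trans (integral_dual_fun_le1 e0 kB xk Ll).
by apply: sum_atoms_le_integral; [exact: undup_uniq|exact: measurable_dual_fun|].
Qed.

Lemma ln_wealth_le_KLinf s l : (0 < size s)%N -> (0 < eps)%R ->
  Lam l -> (0 < wealth l s)%R ->
  (ln (wealth l s))%:E <= (size s)%:R%:E * KLinf B eps (empirical s) x.
Proof.
move=> s0 e0 Ll W0; have N0 : (0 < (size s)%:R :> R)%R by rewrite ltr0n.
rewrite -lee_pdivrMl//; apply: le_ereal_inf_tmp => _ [kappa [kB xk] <-].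
by rewrite lee_pdivrMl//; exact: ln_wealth_le_KL.
Qed.

(** Strong duality. Each observation [y] receives the mass [1 / (size s * h l y)]. By optimality of
    [l], this measure integrates every bet of the region to at most 1, so its missing mass can be
    put at one point [z] to obtain a feasible [kappa]. The density of the empirical law with respect
    to [kappa] is then at most [h l y] at [y]. *)
Lemma KLinf_le_ln_wealth s l : (0 < size s)%N -> (0 < eps)%R -> (0 < B)%R ->
  (x < B `^ p^-1)%R -> Lam l -> (forall l', Lam l' -> (wealth l' s <= wealth l s)%R) ->
  (size s)%:R%:E * KLinf B eps (empirical s) x <= (ln (wealth l s))%:E.
Proof.
move=> s0 e0 B0 xB Ll lmax.
have p1 : (1 < p)%R by rewrite ltrDl.
have N0 : (0 < (size s)%:R :> R)%R by rewrite ltr0n.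
have W0 : (0 < wealth l s)%R.
  by apply: lt_le_trans (lmax _ (dual_region0 _ _ _)); rewrite wealth0.
have [_ _ h0] := Ll.
have hy y : y \in s -> (0 < h l y)%R.
  move=> ys; rewrite lt_neqAle h0 andbT eq_sym.
  by move: (lt0r_neq0 W0); rewrite prodf_seq_neq0 => /allP/(_ _ ys).
have q0 y : (0 <= ((size s)%:R * h l y)^-1)%R by rewrite invr_ge0 mulr_ge0.
pose q y := NngNum (q0 y).
have num l' : Lam l' -> (\sum_(y <- s) (q y)%:num * h l' y <= 1)%R.
  move=> Ll'; have := wealth_argmax_numeraire Ll lmax Ll'.
  rewrite -(@ler_pM2l _ (size s)%:R^-1) ?invr_gt0// mulVf ?gt_eqF// => H; apply: le_trans H.
  by rewrite mulr_sumr ler_sum// => y _; rewrite /q/= invfM -mulrA (mulrC (h l y)^-1%R).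
pose M := (\sum_(y <- s) (q y)%:num)%R.
(* [a] and [b] are the slacks of the weighted sample in the mean and moment constraints; negative
   values must be repaired by the extra atom. *)
pose a := (\sum_(y <- s) (q y)%:num * (y - x))%R.
pose b := (\sum_(y <- s) (q y)%:num * (B - `|y| `^ p))%R.
have aE : (a = \sum_(y <- s) (q y)%:num * y - M * x)%R.
  by rewrite /a /M mulr_suml -sumrB; apply: eq_bigr => y _; rewrite mulrBr.
have bE : (b = M * B - \sum_(y <- s) (q y)%:num * `|y| `^ p)%R.
  by rewrite /b /M mulr_suml -sumrB; apply: eq_bigr => y _; rewrite mulrBr.
have numE l' : (\sum_(y <- s) (q y)%:num * h l' y = M - l'.1 * a - l'.2 * b)%R.
  rewrite /M /a /b !mulr_sumr -!sumrB; apply: eq_bigr => y _; rewrite /dual_fun; ring.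
have w0 : (0 <= 1 - M)%R.
  have := num _ (dual_region0 p B x); rewrite numE/= !mul0r !subr0; lra.
have [z [za zb]] : exists z, (0 <= a + (1 - M) * (z - x))%R /\
    (0 <= b + (1 - M) * (B - `|z| `^ p))%R.
  apply: (moment_completion p1 B0 xB w0) => l' /num; rewrite numE; lra.
pose c := (NngNum w0, z) :: [seq (q y, y) | y <- s].
have c1 : (\sum_(u <- c) u.1%:num = 1)%R by rewrite big_cons big_map/= -/M subrK.
have [kappa kE] := exists_discrete_probability c1.
have kint (f : R -> \bar R) g : measurable_fun setT f -> (forall y, f y = (g y)%:E) ->
    \int[kappa]_y f y = ((1 - M) * g z + \sum_(y <- s) (q y)%:num * g y)%R%:E.
  move=> mf fg; rewrite (eq_measure_integral (discrete c)); last by move=> C mC _; exact: kE.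
  by rewrite (integral_discrete (g := g))// big_cons big_map.
have kB : moment_class B eps kappa.
  rewrite /moment_class/= (kint _ (fun y => `|y| `^ p)%R)//; last first.
    by apply/measurable_EFinP; exact: measurable_norm_powR.
  rewrite lee_fin -subr_ge0; apply: le_trans zb _; rewrite le_eqVlt; apply/orP; left; apply/eqP.
  by rewrite bE; ring.
have xk : (x <= mean kappa)%R.
  rewrite /mean /Rintegral (kint _ id)//.
  rewrite /= -subr_ge0; apply: le_trans za _; rewrite le_eqVlt; apply/orP; left; apply/eqP.
  by rewrite aE; ring.
(* Only an inequality, because the extra atom [z] may coincide with an observation. *)
have katom y : ((count_mem y s)%:R * (q y)%:num)%:E <= kappa [set y].
  rewrite kE; last exact: measurable_set1.
  rewrite discreteE lee_fin big_cons big_map/=.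
  apply: (@le_trans _ _ (\sum_(u <- s) (q u)%:num * \1_[set y] u)%R); last first.
    by rewrite lerDr mulr_ge0.
  rewrite -sum1_count natr_sum mulr_suml big_mkcond/= ler_sum// => u _.
  rewrite indicE (_ : (u \in [set y]%classic) = (u == y)); last first.
    by apply/idP/eqP; rewrite inE.
  by case: eqVneq => [->|_]; rewrite ?mul1r ?mulr1 ?mulr0 ?mul0r.
have sk : empirical s `<< kappa.
  apply/null_content_dominatesP => C mC k0.
  have : discrete c C = 0 by rewrite -kE.
  rewrite discreteE big_cons big_map => -[C0].
  have {C0} C0 y : y \in s -> ~ C y.
    move=> ys Cy.
    have : (0 < \sum_(u <- s) (q u)%:num * \1_C u)%R.
      rewrite (big_rem y)//= ltr_pwDl ?sumr_ge0// => [|u _]; last by rewrite mulr_ge0.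
      by rewrite indicE mem_set// mulr1 /q/= invr_gt0 mulr_gt0 ?hy.
    have : (0 <= (1 - M) * \1_C z)%R by rewrite mulr_ge0.
    move: C0 => /=; lra.
  apply: etrans (empiricalE C s0) _; rewrite (_ : count _ _ = 0%N) ?mul0r//.
  apply/eqP; rewrite -leqn0 leqNgt -has_count; apply/hasPn => y ys.
  by apply/asboolP; exact: C0.
apply: (@le_trans _ _ ((size s)%:R%:E * KL (empirical s) kappa)).
  rewrite lee_pmul2l// ?lte_fin//; apply: ereal_inf_lbound; by exists kappa.
rewrite KL_empirical// lee_fin /wealth ln_prod//.
rewrite big_seq [leRHS]big_seq; apply: ler_sum => y ys.
have c0 : (0 < (count_mem y s)%:R :> R)%R by rewrite ltr0n -has_count has_pred1.
have k0 := empirical_dominates_set1 sk ys.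
rewrite ler_ln ?posrE ?hy//; last by rewrite !divr_gt0.
rewrite ler_pdivrMr// ler_pdivrMr//.
have := katom y; rewrite -[kappa _]fineK ?fin_num_measure// lee_fin.
rewrite /q/= ler_pdivrMr; last by rewrite mulr_gt0 ?hy.
by move=> /le_trans; apply; rewrite le_eqVlt; apply/orP; left; apply/eqP; ring.
Qed.

Lemma KLinf_empirical s : (0 < size s)%N -> (0 < eps)%R -> (0 < B)%R ->
  (x < B `^ p^-1)%R ->
  exists l, [/\ Lam l, (0 < wealth l s)%R,
    forall l', Lam l' -> (wealth l' s <= wealth l s)%R &
    (size s)%:R%:E * KLinf B eps (empirical s) x = (ln (wealth l s))%:E].
Proof.
move=> s0 e0 B0 xB; have p1 : (1 < p)%R by rewrite ltrDl.
have [l Ll lmax] := wealth_argmax s p1 B0 xB.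
have W0 : (0 < wealth l s)%R.
  by apply: lt_le_trans (lmax _ (dual_region0 _ _ _)); rewrite wealth0.
exists l; split => //; apply/eqP; rewrite eq_le.
by rewrite KLinf_le_ln_wealth//= ln_wealth_le_KLinf.
Qed.

End duality.

(** * Integrating a past quantity times a fresh reward *)

Section independent_product.
Local Open Scope ereal_scope.

Lemma ge0_integral_mfrestr d (T : measurableType d) (R : realType)
    (m : {measure set T -> \bar R}) (G : set T) (mG : measurable G) (Goo : m G < +oo)
    (f : T -> \bar R) : measurable_fun setT f -> (forall x, 0 <= f x) ->
  \int[mfrestr mG Goo]_x f x = \int[m]_(x in G) f x.
Proof.
move=> mf f0; rewrite -(setUv G) ge0_integral_setU//; last 3 first.
- exact: measurableC.
- by rewrite setUv.
- by rewrite disj_set2E setICr.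
rewrite [X in _ + X](_ : _ = 0) ?adde0.
  apply: eq_measure_integral => C mC CG.
  by transitivity (m (C `&` G)); rewrite // setIidl.
rewrite -(integral_measure_zero (~` G) f).
apply: eq_measure_integral => C mC CG.
transitivity (m (C `&` G)) => //.
by rewrite (_ : C `&` G = set0) ?measure0//; exact/disjoints_subset.
Qed.

Lemma ge0_integral_pushforward_measure d1 d2 (T1 : measurableType d1)
    (T2 : measurableType d2) (R : realType) (m : {measure set T1 -> \bar R})
    (f : T1 -> T2) (mf : measurable_fun setT f) (g : T2 -> \bar R) :
  measurable_fun setT g -> (forall y, 0 <= g y) ->
  \int[pushforward_measure m mf]_y g y = \int[m]_x g (f x).
Proof.
move=> mg g0; by rewrite ge0_integral_pushforward// preimage_setT.
Qed.

(** Under [P] restricted to [G], the joint law of [Z] and [V] agrees on rectangles with the product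
    of the law of [Z] and [nu]; Tonelli's theorem then factors the integral. *)
Lemma integral_mul_indep d (Om : measurableType d) (R : realType)
    (P : probability Om R) (G : set Om) (Z V : Om -> R) (f : R -> R)
    (nu : borel_probability R) :
  measurable G ->
  (forall D C : set (measurableTypeR R), measurable D -> measurable C ->
    P (G `&` Z @^-1` D `&` V @^-1` C) = P (G `&` Z @^-1` D) * nu C) ->
  measurable_fun setT Z -> measurable_fun setT V -> measurable_fun setT f ->
  (forall w, (0 <= Z w)%R) -> (forall y, (0 <= f y)%R) ->
  \int[P]_(w in G) (Z w * f (V w))%:E =
  (\int[P]_(w in G) (Z w)%:E) * \int[nu]_y (f y)%:E.
Proof.
move=> mG indep mZ mV mf Z0 f0.
have Goo : P G < +oo by rewrite (le_lt_trans (probability_le1 _ _)) ?ltry.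
pose PG : {finite_measure set Om -> \bar R} := mfrestr mG Goo.
have mZV : measurable_fun setT (fun w => (Z w, V w) : measurableTypeR R * measurableTypeR R).
  exact: measurable_fun_pair.
have mZ' : measurable_fun setT (Z : Om -> measurableTypeR R) by [].
pose rho : {finite_measure set (measurableTypeR R) -> \bar R} := pushforward_measure PG mZ'.
have jointE X : measurable X -> (rho \x nu) X = pushforward_measure PG mZV X.
  apply: product_measure_unique => D C mD mC.
  transitivity (P (G `&` Z @^-1` D `&` V @^-1` C)).
    transitivity (P ((fun w => (Z w, V w)) @^-1` (D `*` C) `&` G)) => //.
    by congr (P _); apply/seteqP; split => w /=; tauto.
  rewrite indep//; congr (_ * _).
  by transitivity (P (Z @^-1` D `&` G)); rewrite // setIC.
(* The absolute value makes the integrand nonnegative on the whole plane, and changes nothing along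
   [Z]. *)
pose g (u : measurableTypeR R * measurableTypeR R) : \bar R := (`|u.1| * f u.2)%:E.
have mg : measurable_fun setT g.
  apply/measurable_EFinP; apply: measurable_funM.
    by apply: measurableT_comp.
  by apply: measurableT_comp.
have g0 u : 0 <= g u by rewrite lee_fin mulr_ge0.
have -> : \int[P]_(w in G) (Z w * f (V w))%:E = \int[PG]_w g (Z w, V w).
  rewrite ge0_integral_mfrestr//; last exact: measurableT_comp.
  by apply: eq_integral => w _; rewrite /g/= ger0_norm.
rewrite -(ge0_integral_pushforward_measure PG mZV mg g0).
rewrite (eq_measure_integral (rho \x nu)); last by move=> X mX _; apply/esym; exact: jointE.
rewrite fubini_tonelli1// /fubini_F.
have mabs : measurable_fun setT (fun z : measurableTypeR R => `|z|%:E : \bar R).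
  by apply/measurable_EFinP; exact: normr_measurable.
under eq_integral.
  move=> z _; rewrite (_ : (fun y => g (z, y)) = (fun y => `|z|%:E * (f y)%:E)); last first.
    by apply/funext => y; rewrite -EFinM.
  rewrite ge0_integralZl//; [|exact/measurable_EFinP|by move=> y _; rewrite lee_fin].
  over.
rewrite ge0_integralZr//; last by apply: integral_ge0 => y _; rewrite lee_fin.
congr (_ * _).
rewrite ge0_integral_pushforward_measure// ge0_integral_mfrestr//; last first.
  by apply/measurable_EFinP; exact: measurableT_comp.
by apply: eq_integral => w _; rewrite ger0_norm.
Qed.

End independent_product.

(** * Tonelli's theorem on measurable rectangles *)

Section tonelli_on_rectangles.
Local Open Scope ereal_scope.

(** The integrand is extended by 0 outside the rectangle. Its sign is prescribed for [y] in [L]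
    only, since wealth can be negative outside the dual region. *)
Lemma fubini_tonelli_setX d1 d2 (T1 : measurableType d1) (T2 : measurableType d2)
    (R : realType) (m1 : {sigma_finite_measure set T1 -> \bar R})
    (m2 : {sigma_finite_measure set T2 -> \bar R}) (D : set T1) (L : set T2)
    (f : T1 * T2 -> \bar R) : measurable D -> measurable L ->
  measurable_fun setT f -> (forall x y, L y -> 0 <= f (x, y)) ->
  \int[m1]_(x in D) \int[m2]_(y in L) f (x, y) =
  \int[m2]_(y in L) \int[m1]_(x in D) f (x, y).
Proof.
move=> mD mL mf f0; pose g := f \_ (D `*` L).
have mg : measurable_fun setT g.
  apply/(measurable_restrictT f); first exact: measurableX.
  exact: measurable_funTS.
have g0 u : 0 <= g u.
  by rewrite /g patchE; case: ifPn => // /set_mem[_ Lu]; case: u Lu => ? ? /f0.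
have gE x y : g (x, y) = if (x \in D) && (y \in L) then f (x, y) else 0.
  by rewrite /g patchE in_setX.
transitivity (\int[m1]_x \int[m2]_y g (x, y)).
  rewrite integral_mkcond; apply: eq_integral => x _; rewrite patchE.
  case: ifPn => xD; last first.
    by under [RHS]eq_integral do rewrite gE (negbTE xD)/=; rewrite integral0.
  rewrite integral_mkcond; apply: eq_integral => y _.
  by rewrite patchE gE xD.
rewrite fubini_tonelli//.
rewrite [RHS]integral_mkcond; apply: eq_integral => y _; rewrite patchE.
case: ifPn => yL; last first.
  by under eq_integral do rewrite gE (negbTE yL) andbF; rewrite integral0.
rewrite [RHS]integral_mkcond; apply: eq_integral => x _.
by rewrite patchE gE yL andbT.
Qed.

Lemma measurable_fun_integral_setXl d1 d2 (T1 : measurableType d1) (T2 : measurableType d2)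
    (R : realType) (m2 : {sigma_finite_measure set T2 -> \bar R}) (D : set T1) (L : set T2)
    (f : T1 * T2 -> \bar R) : measurable D -> measurable L ->
  measurable_fun setT f -> (forall x y, L y -> 0 <= f (x, y)) ->
  measurable_fun D (fun x => \int[m2]_(y in L) f (x, y)).
Proof.
move=> mD mL mf f0; pose g := f \_ (D `*` L).
have mg : measurable_fun setT g.
  apply/(measurable_restrictT f); first exact: measurableX.
  exact: measurable_funTS.
have g0 u : 0 <= g u.
  by rewrite /g patchE; case: ifPn => // /set_mem[_ Lu]; case: u Lu => ? ? /f0.
apply: (eq_measurable_fun (fubini_F m2 g)); last first.
  by apply: measurable_funTS; exact: measurable_fun_fubini_tonelli_F.
move=> x xD; rewrite /fubini_F [RHS]integral_mkcond; apply: eq_integral => y _.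
by rewrite /g !patchE in_setX xD.
Qed.

Lemma measurable_fun_integral_setXr d1 d2 (T1 : measurableType d1) (T2 : measurableType d2)
    (R : realType) (m1 : {sigma_finite_measure set T1 -> \bar R}) (D : set T1) (L : set T2)
    (f : T1 * T2 -> \bar R) : measurable D -> measurable L ->
  measurable_fun setT f -> (forall x y, L y -> 0 <= f (x, y)) ->
  measurable_fun L (fun y => \int[m1]_(x in D) f (x, y)).
Proof.
move=> mD mL mf f0; pose g := f \_ (D `*` L).
have mg : measurable_fun setT g.
  apply/(measurable_restrictT f); first exact: measurableX.
  exact: measurable_funTS.
have g0 u : 0 <= g u.
  by rewrite /g patchE; case: ifPn => // /set_mem[_ Lu]; case: u Lu => ? ? /f0.
apply: (eq_measurable_fun (fubini_G m1 g)); last first.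
  by apply: measurable_funTS; exact: measurable_fun_fubini_tonelli_G.
move=> y yL; rewrite /fubini_G [RHS]integral_mkcond; apply: eq_integral => x _.
by rewrite /g !patchE in_setX yL andbT.
Qed.

End tonelli_on_rectangles.

(** * The wealth process of one arm *)

Section bandit.
Context d (Om : measurableType d) (R : realType) (P : probability Om R) (K : nat)
  (mu : 'I_K -> borel_probability R) (F : nat -> set (set Om))
  (A : nat -> Om -> 'I_K) (Y : nat -> Om -> R) (b : 'I_K) (B eps : R).
Hypothesis bm : bandit_model P mu F A Y.
Local Notation p := (1 + eps).
Local Notation x := (mean (mu b)).
Local Notation Lam := (dual_region p B x).
Local Notation h := (dual_fun p B x).
Local Notation wealth := (wealth p B x).
Local Notation Hist t := (g_sigma_algebraType (F t)).

(** [Hist t] is the sample space with [F t] as its sigma-algebra: adaptedness becomes ordinary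
    measurability. *)
Lemma historyE t (C : set Om) : (measurable (C : set (Hist t))) = F t C.
Proof. by rewrite measurable_g_measurableTypeE//; exact: (history_sigma_algebra bm). Qed.

Lemma history_measurable_fun t d' (T' : measurableType d') (f : Om -> T') :
  measurable_fun setT (f : Hist t -> T') -> measurable_fun setT f.
Proof.
move=> mf _ C mC; rewrite setTI; apply: (history_measurable bm (t := t)).
by rewrite -historyE -[X in measurable X]setTI; exact: mf.
Qed.

Lemma history_preimage t d' (T' : measurableType d') (f : Om -> T') (C : set T') :
  measurable_fun setT (f : Hist t -> T') -> measurable C -> F t (f @^-1` C).
Proof. by move=> mf mC; rewrite -historyE -[X in measurable X]setTI; exact: mf. Qed.

Lemma reward_history s t : (0 < s <= t)%N ->
  measurable_fun setT (Y s : Hist t -> measurableTypeR R).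
Proof.
case: s => // s /andP[_ st] _ C mC; rewrite setTI historyE.
by apply: (history_nondecreasing bm st); exact: (reward_adapted bm).
Qed.

(** The range goes one trial further than for the rewards, because the arm of trial [t.+1] is chosen
    from [F t]. *)
Lemma arm_history s t : (0 < s <= t.+1)%N ->
  measurable_fun setT ((fun w => A s w == b) : Hist t -> bool).
Proof.
case: s => // s /andP[_ st] mT; apply: (measurable_fun_bool true) => //.
rewrite setTI historyE; apply: (history_nondecreasing bm (st : s <= t)%N).
rewrite (_ : _ @^-1` _ = A s.+1 @^-1` [set b]); first exact: (arm_predictable bm).
by apply/seteqP; split => w /= /eqP.
Qed.

(** The wealth after the trials 1 to [t], that is, at time [t.+1]. Pulls of other arms contribute
    the factor 1, so the process is indexed by trials and not by samples of [b]. *)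
Definition gain (l : R * R) (t : nat) (w : Om) : R :=
  \prod_(1 <= s < t.+1) (if A s w == b then h l (Y s w) else 1).

Lemma wealth_samples l t w : wealth l (samples A Y b t.+1 w) = gain l t w.
Proof. by rewrite /wealth /samples big_map big_filter big_mkcond. Qed.

Lemma size_samples n w : size (samples A Y b n w) = pulls A b n w.
Proof. by rewrite size_map size_filter. Qed.

Lemma gain0 l w : gain l 0 w = 1. Proof. by rewrite /gain big_geq. Qed.

Lemma gainS l t w : gain l t.+1 w =
  gain l t w * (if A t.+1 w == b then h l (Y t.+1 w) else 1).
Proof. by rewrite /gain big_nat_recr. Qed.

Lemma gain_ge0 l t w : Lam l -> 0 <= gain l t w.
Proof. by move=> [_ _ l0]; apply: prodr_ge0 => s _; case: ifPn. Qed.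

Lemma gain_history l t : measurable_fun setT (gain l t : Hist t -> R).
Proof.
apply: (@measurable_prod _ (Hist t)) => s; rewrite mem_index_iota => /andP[s0 st].
apply: measurable_fun_ifT => //.
  by apply: arm_history; rewrite s0 ltnW.
apply: measurableT_comp; first exact: measurable_dual_fun.
by apply: reward_history; rewrite s0.
Qed.

Lemma measurable_gain l t : measurable_fun setT (gain l t).
Proof. exact: history_measurable_fun (@gain_history l t). Qed.

Lemma measurable_gain_pair t :
  measurable_fun setT (fun u : Om * (measurableTypeR R * measurableTypeR R) => gain u.2 t u.1).
Proof.
apply: measurable_prod => s; rewrite mem_index_iota => /andP[s0 st].
have mA : measurable_fun setT (fun w => A s w == b).
  by apply: (@history_measurable_fun t); apply: arm_history; rewrite s0 ltnW.
have mY : measurable_fun setT (Y s : Om -> measurableTypeR R).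
  by apply: (@history_measurable_fun t); apply: reward_history; rewrite s0.
apply: measurable_fun_ifT => //; first exact: (measurableT_comp mA measurable_fst).
rewrite (_ : (fun u => _) = (fun u : Om * (measurableTypeR R * measurableTypeR R) =>
  h (u.2.1, u.2.2) (Y s u.1))); last by apply/funext => -[? []].
apply: measurable_dual_fun_comp.
- exact: (measurableT_comp measurable_fst measurable_snd).
- exact: (measurableT_comp measurable_snd measurable_snd).
- exact: (measurableT_comp mY measurable_fst).
Qed.

Lemma pulls_history t :
  measurable_fun setT ((fun w => (pulls A b t.+1 w)%:R) : Hist t -> R).
Proof.
rewrite (_ : (fun w => _) = (fun w => \sum_(s < t) (if A s.+1 w == b then 1 else 0))).
  apply: (@measurable_sum _ (Hist t)) => s.
  apply: measurable_fun_ifT => //; apply: arm_history; exact: leqW (ltn_ord s).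
apply/funext => w; rewrite /pulls -sum1_count natr_sum big_mkcond big_add1 big_mkord.
by apply: eq_bigr => s _; case: ifP.
Qed.

Local Open Scope ereal_scope.

Lemma history_sub t (C D : set Om) : F t C -> F t D -> F t (C `&` D).
Proof. by rewrite -!historyE; exact: measurableI. Qed.

(** The supermartingale property without conditional expectations, integrated over an event of the
    history. Where arm [b] is pulled, the new factor is independent of the gain and has mean at most
    1; elsewhere the gain does not move. *)
Lemma gain_supermartingale l t (G : set Om) : (0 < eps)%R ->
  moment_class B eps (mu b) -> Lam l -> F t G ->
  \int[P]_(w in G) (gain l t.+1 w)%:E <= \int[P]_(w in G) (gain l t w)%:E.
Proof.
move=> e0 mB Ll FG; have [_ _ h0] := Ll.
pose Ab := A t.+1 @^-1` [set b].
have FA : F t Ab by exact: (arm_predictable bm).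
have FGA : F t (G `&` Ab) by exact: history_sub.
have FGC : F t (G `\` Ab) by rewrite -historyE; apply: measurableD; rewrite historyE.
have mG := history_measurable bm FG.
have mGA := history_measurable bm FGA; have mGC := history_measurable bm FGC.
have mg s : measurable_fun setT (fun w => (gain l s w)%:E).
  by apply/measurable_EFinP; exact: measurable_gain.
have GE : G = (G `&` Ab) `|` (G `\` Ab) by rewrite setUIDK.
have split s : \int[P]_(w in G) (gain l s w)%:E =
    \int[P]_(w in G `&` Ab) (gain l s w)%:E + \int[P]_(w in G `\` Ab) (gain l s w)%:E.
  rewrite {1}GE ge0_integral_setU//.
  - exact: measurable_funTS.
  - by move=> w _; rewrite lee_fin gain_ge0.
  - by rewrite disj_set2E; apply/eqP; rewrite -subset0 => w [[_ ?] [_ +]].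
rewrite !split; apply: leeD; last first.
  rewrite le_eqVlt; apply/orP; left; apply/eqP; apply: eq_integral => w.
  rewrite inE => -[_ nA]; rewrite gainS; case: eqP => [/nA//|_]; by rewrite mulr1.
rewrite (eq_integral (fun w => (gain l t w * h l (Y t.+1 w))%:E)); last first.
  by move=> w; rewrite inE => -[_ wA]; rewrite gainS ifT//; apply/eqP.
rewrite (@integral_mul_indep _ _ _ P _ _ _ _ (mu b))//.
- rewrite -[leRHS]mule1; apply: lee_wpmul2l.
    by apply: integral_ge0 => w _; rewrite lee_fin gain_ge0.
  exact: integral_dual_fun_le1.
- move=> D C mD mC.
  (* The reward law holds over all events of [F t], including those that prescribe the value of the
     current gain. *)
  have FZ : F t (G `&` gain l t @^-1` D).
    by apply: history_sub => //; apply: history_preimage mD; exact: gain_history.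
  by rewrite !(setIAC G Ab); exact: (reward_law bm b FZ mC).
- exact: measurable_gain.
- by apply: (@history_measurable_fun t.+1); apply: reward_history; rewrite /= leqnn.
- exact: measurable_dual_fun.
- by move=> w; exact: gain_ge0.
Qed.

(** Optional stopping at the first entrance: [seqDU E t] is the event that [E] occurs at [t] for the
    first time. *)
Lemma sum_first_entrance_gain l (E : nat -> set Om) n : (0 < eps)%R ->
  moment_class B eps (mu b) -> Lam l -> (forall t, F t (E t)) ->
  \sum_(t < n) \int[P]_(w in seqDU E t) (gain l t w)%:E <= 1.
Proof.
move=> e0 mB Ll FE.
pose C n := ~` \big[setU/set0]_(i < n) E i.
have mg s : measurable_fun setT (fun w => (gain l s w)%:E).
  by apply/measurable_EFinP; exact: measurable_gain.
have FU t : F t (\big[setU/set0]_(i < t.+1) E i).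
  rewrite -historyE; apply: bigsetU_measurable => i _; rewrite historyE.
  by apply: (history_nondecreasing bm _ (FE i)); rewrite -ltnS.
have FU' t : F t (\big[setU/set0]_(i < t) E i).
  rewrite -historyE; apply: bigsetU_measurable => i _; rewrite historyE.
  by apply: (history_nondecreasing bm _ (FE i)); rewrite ltnW.
have FC t : F t (C t.+1) by rewrite -historyE; apply: measurableC; rewrite historyE.
have FD t : F t (seqDU E t).
  by rewrite -historyE; apply: measurableD; rewrite historyE.
(* The integral over the paths not yet stopped is added to make the induction work: each step splits
   [C n] into a first entrance at [n] and [C n.+1]. *)
apply: (@le_trans _ _
      (\sum_(t < n) \int[P]_(w in seqDU E t) (gain l t w)%:E +
    \int[P]_(w in C n) (gain l n w)%:E)).
  by rewrite leeDl// integral_ge0// => w _; rewrite lee_fin gain_ge0.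
elim: n => [|n ih].
  rewrite big_ord0 add0e /C big_ord0 setC0.
  under eq_integral do rewrite gain0.
  by rewrite (integral_cst P measurableT 1) mul1e -(probability_setT P).
apply: le_trans ih; rewrite big_ord_recr/= -addeA; apply: leeD2l.
have -> : \int[P]_(w in C n) (gain l n w)%:E =
    \int[P]_(w in seqDU E n) (gain l n w)%:E + \int[P]_(w in C n.+1) (gain l n w)%:E.
  rewrite -ge0_integral_setU//.
  - congr (integral _ _ _); rewrite /C /seqDU big_ord_recr/=.
    apply/seteqP; split => w /=.
    + by move=> h1; have [h2|h2] := pselect (E n w); [left|right => -[]].
    + by move=> [[_ //]|h1 h2]; apply: h1; left.
  - exact: (history_measurable bm (FD n)).
  - exact: (history_measurable bm (FC n)).
  - exact: measurable_funTS.
  - by move=> w _; rewrite lee_fin gain_ge0.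
  - rewrite disj_set2E; apply/eqP; rewrite -subset0 => w [[h1 _] h2].
    by apply: h2; rewrite big_ord_recr; right.
by apply: leeD2l; exact: gain_supermartingale.
Qed.

End bandit.

(** Bernoulli's inequality, used to control the wealth lost in moving to a rational point. *)
Lemma one_sub_mul_le_expr (R : realDomainType) (v : R) (n : nat) : 0 <= v <= 1 ->
  1 - n%:R * v <= (1 - v) ^+ n.
Proof.
move=> /andP[v0 v1]; elim: n => [|n ih]; first by rewrite mul0r subr0.
have v1' : 0 <= 1 - v by rewrite subr_ge0.
rewrite exprS -natr1; apply: le_trans (ler_wpM2l v1' ih).
have : 0 <= n%:R * v * v by rewrite !mulr_ge0.
by move: (n%:R : R) => m; lra.
Qed.

(** * Deviations as a condition on the wealth *)

Section deviation_threshold.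
Context {R : realType} (B eps x : R).
Hypotheses (e0 : 0 < eps) (B0 : 0 < B) (xB : x < B `^ (1 + eps)^-1).
Local Notation p := (1 + eps).
Local Notation Lam := (dual_region p B x).
Local Notation wealth := (wealth p B x).

(** Strong duality, exponentiated. An existential over [l] suits both the mixture bound and the
    passage to rational points. *)
Lemma KLinf_deviationP (s : seq R) (x0 : R) : (0 < size s)%N ->
  (x0%:E <= (size s)%:R%:E * KLinf B eps (empirical s) x
    - 1 - (2 * ln (1 + (size s)%:R))%R%:E)%E <->
  exists2 l, Lam l & expR (x0 + 1) * (1 + (size s)%:R) ^+ 2 <= wealth l s.
Proof.
move=> s0; have [l [Ll W0 lmax ->]] := KLinf_empirical s0 e0 B0 xB.
have n0 : 0 < 1 + (size s)%:R :> R by rewrite ltr_pwDl.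
have n2 : 0 < (1 + (size s)%:R) ^+ 2 :> R by rewrite exprn_gt0.
have -> : (x0%:E <= (ln (wealth l s))%:E - 1 - (2 * ln (1 + (size s)%:R))%R%:E)%E =
    (expR (x0 + 1) * (1 + (size s)%:R) ^+ 2 <= wealth l s).
  rewrite -!EFinB lee_fin -ler_ln ?posrE ?mulr_gt0 ?expR_gt0//.
  rewrite lnM ?posrE ?expR_gt0// expRK lnXn// -mulr_natl.
  by apply/idP/idP; lra.
split=> [?|[l' Ll' /le_trans]]; first by exists l.
by apply; exact: lmax.
Qed.

(** A maximizer need not be rational, hence the slack [1 / (k + 1)]; conversely, the maximum over
    the compact region is attained, so the slack can tend to 0. *)
Lemma wealth_ge_rationalP (s : seq R) (c : R) :
  (exists2 l, Lam l & c <= wealth l s) <->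
  forall k : nat, exists q1 q2 : rat,
    Lam (ratr q1, ratr q2) /\ c - k.+1%:R^-1 < wealth (ratr q1, ratr q2) s.
Proof.
have p1 : 1 < p by rewrite ltrDl.
split=> [[l Ll cl] k|H].
  have W0 := wealth_ge0 s Ll.
  (* With the shrinking factor [1 / u], the loss [size s * wealth l s / u] is below [1 / (k + 1)];
     the added 1 makes this strict and ensures [u >= 1]. *)
  pose u : R := k.+1%:R * ((size s)%:R * wealth l s + 1).
  have u1 : 1 <= u.
    rewrite -[leLHS]mul1r; apply: ler_pM => //; first by rewrite ler1n.
    by rewrite lerDr mulr_ge0.
  have u0 : 0 < u by exact: lt_le_trans u1.
  have t01 : 0 < u^-1 <= 1 by rewrite invr_gt0 u0 invf_le1.
  have [[q1 q2]/= [Lq qW]] := dual_region_rational_dense s p1 B0 Ll t01.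
  exists q1, q2; split => //; apply: lt_le_trans qW.
  have bern := @one_sub_mul_le_expr R (u^-1) (size s).
  apply: (@lt_le_trans _ _ ((1 - (size s)%:R * u^-1) * wealth l s)); last first.
    by rewrite ler_wpM2r// bern//; case/andP: t01 => ? ->; rewrite ltW.
  have k0 : 0 < k.+1%:R :> R by rewrite ltr0n.
  have v0 : 0 < (size s)%:R * wealth l s + 1 by rewrite ltr_wpDl ?mulr_ge0.
  have -> : (1 - (size s)%:R * u^-1) * wealth l s =
      wealth l s - k.+1%:R^-1 * (((size s)%:R * wealth l s) / ((size s)%:R * wealth l s + 1)).
    by rewrite /u; field; rewrite !gt_eqF.
  apply: (@le_lt_trans _ _ (wealth l s - k.+1%:R^-1)); first by rewrite lerD2r.
  by rewrite ltrD2l ltrN2 gtr_pMr ?invr_gt0// ltr_pdivrMr// mul1r ltrDl.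
have [l Ll lmax] := wealth_argmax s p1 B0 xB.
exists l => //; rewrite leNgt; apply/negP => lc.
pose k := Num.bound (c - wealth l s)^-1.
have e1 : 0 < c - wealth l s by rewrite subr_gt0.
have kE : k.+1%:R^-1 < c - wealth l s.
  rewrite -[ltRHS]invrK ltf_pV2 ?posrE ?invr_gt0// ?ltr0n//.
  have : (c - wealth l s)^-1 < k%:R by apply: archi_boundP; rewrite invr_ge0 ltW.
  by move=> /lt_trans; apply; rewrite ltr_nat.
have [q1 [q2 [/lmax h1 h2]]] := H k.
have := lt_trans (lt_le_trans h2 h1) (_ : wealth l s < c - k.+1%:R^-1).
by rewrite ltxx ltrBrDl -ltrBrDr => /(_ kE).
Qed.

End deviation_threshold.

(** * Ville's inequality for the deviation events *)

Section deviation_bound.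
Context d (Om : measurableType d) (R : realType) (P : probability Om R) (K : nat)
  (mu : 'I_K -> borel_probability R) (F : nat -> set (set Om))
  (A : nat -> Om -> 'I_K) (Y : nat -> Om -> R) (b : 'I_K) (B eps : R).
Hypotheses (bm : bandit_model P mu F A Y) (e0 : 0 < eps) (B0 : 0 < B)
  (mB : moment_class B eps (mu b)).
Local Notation p := (1 + eps).
Local Notation x := (mean (mu b)).
Local Notation Lam := (dual_region p B x).
Local Notation wealth := (wealth p B x).
Local Notation Hist t := (g_sigma_algebraType (F t)).
Local Notation gain := (gain mu A Y b B eps).
Local Open Scope ereal_scope.

Definition deviation (x0 : R) (n : nat) : set Om :=
  [set w | (1 <= pulls A b n w)%N /\
     (pulls A b n w)%:R%:E * KLinf B eps (empirical (samples A Y b n w)) x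
       - 1 - (2 * ln (1 + (pulls A b n w)%:R))%R%:E >= x0%:E].

Section interior_mean.
Hypothesis xB : (x < B `^ p^-1)%R.

Lemma deviationP x0 n w : deviation x0 n w <-> (1 <= pulls A b n w)%N /\
  exists2 l, Lam l &
    (expR (x0 + 1) * (1 + (pulls A b n w)%:R) ^+ 2 <= wealth l (samples A Y b n w))%R.
Proof.
rewrite /deviation/= -(size_samples A Y b n w).
by split=> -[s0 H]; split => //; apply/KLinf_deviationP.
Qed.

(** Time [t.+1] sees the trials 1 to [t], hence [F t]. Duality and rational parameters reduce the
    event to countably many comparisons of gains with thresholds. *)
Lemma deviation_history x0 t : F t (deviation x0 t.+1).
Proof.
rewrite -(historyE bm).
pose c w := (expR (x0 + 1) * (1 + (pulls A b t.+1 w)%:R) ^+ 2)%R.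
pose D k q1 q2 := [set w | Lam (ratr q1, ratr q2) /\
  (c w - k.+1%:R^-1 < gain (ratr q1, ratr q2) t w)%R].
have -> : deviation x0 t.+1 = [set w | (0 < (pulls A b t.+1 w)%:R :> R)%R] `&`
    \bigcap_k \bigcup_q1 \bigcup_q2 D k q1 q2.
  apply/seteqP; split => w.
    move=> /deviationP[s0 /(wealth_ge_rationalP e0 B0 xB) H]; split; first by rewrite /= ltr0n.
    move=> k _; have [q1 [q2 [Lq cq]]] := H k.
    by exists q1 => //; exists q2 => //; split => //; rewrite -wealth_samples.
  move=> [/=]; rewrite ltr0n => s0 H; apply/deviationP; split => //.
  apply/(wealth_ge_rationalP e0 B0 xB) => k; have [q1 _ [q2 _ [Lq cq]]] := H k I.
  by exists q1, q2; split => //; rewrite wealth_samples.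
have mN : measurable_fun setT ((fun w => (pulls A b t.+1 w)%:R%R) : Hist t -> R).
  exact: (pulls_history _ bm).
have mc : measurable_fun setT (c : Hist t -> R).
  by apply: measurable_funM => //; apply: measurable_funX; apply: measurable_funD.
apply: measurableI.
  have := @measurable_fun_ltr _ (Hist t) R setT (cst 0%R) _ (measurable_cst _) mN
    measurableT [set true] I.
  by rewrite setTI.
apply: bigcap_measurableType => k _.
apply: bigcupT_measurable_rat => q1; apply: bigcupT_measurable_rat => q2.
have [Lq|nLq] := pselect (Lam (ratr q1, ratr q2)); last first.
  by rewrite (_ : D _ _ _ = set0) -?subset0// => w [].
have mg : measurable_fun setT (gain (ratr q1, ratr q2) t : Hist t -> R).
  exact: (gain_history _ _ _ bm).
have := @measurable_fun_ltr _ (Hist t) R setT (fun w => c w - k.+1%:R^-1)%R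
  (gain (ratr q1, ratr q2) t).
move=> /(_ _ mg measurableT [set true] I).
rewrite setTI (_ : D _ _ _ =
    (fun w => c w - k.+1%:R^-1 < gain (ratr q1, ratr q2) t w)%R @^-1` [set true]).
  by apply; apply: measurable_funB.
by apply/seteqP; split => w /=; [case|split].
Qed.

(** The terms [1 + 2 ln (1 + N)] of the deviation cancel exactly the factor [exp (-1) / (1 + N) ^ 2]
    lost by averaging. *)
Lemma mixture_gain_ge x0 t w : deviation x0 t.+1 w ->
  (expR x0)%:E * area Lam <= \int[area]_(l in Lam) (gain l t w)%:E.
Proof.
move=> /deviationP[s0 [l Ll cl]].
under eq_integral do rewrite -wealth_samples.
rewrite -(size_samples A Y) in s0 cl.
apply: le_trans (integral_wealth_ge s0 Ll).
apply: lee_wpmul2r; first exact: measure_ge0.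
rewrite lee_fin ler_pdivlMr ?exprn_gt0 ?ltr_pwDl//.
have : (expR (-1) * (expR (x0 + 1) * (1 + (size (samples A Y b t.+1 w))%:R) ^+ 2) <=
  expR (-1) * wealth l (samples A Y b t.+1 w))%R by rewrite ler_wpM2l ?expR_ge0.
by rewrite mulrA -expRD addrCA addNr addr0 [leRHS]mulrC.
Qed.

(** On a first deviation the integrated gain is at least [expR x0 * area Lam]. After exchanging
    integrals, optional stopping bounds the total by 1 for each [l], hence by [area Lam] overall;
    this area is positive and finite, so it cancels. *)
Lemma sum_first_deviation_le x0 n :
  \sum_(t < n) P (seqDU (fun t => deviation x0 t.+1) t) <= (expR (- x0))%:E.
Proof.
set E := fun t => deviation x0 t.+1.
have p1 : (1 < p)%R by rewrite ltrDl.
have FE t : F t (E t) by exact: deviation_history.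
have mE t : measurable (E t) by exact: (history_measurable bm (FE t)).
have mD t : measurable (seqDU E t) by apply: measurableD => //; apply: bigsetU_measurable.
have a0 : 0 < area Lam by exact: area_dual_region_gt0.
have aoo : area Lam < +oo by exact: area_dual_region_lty.
have mL := measurable_dual_region p B x.
pose f t (u : Om * (measurableTypeR R * measurableTypeR R)) := (gain u.2 t u.1)%:E.
have mf t : measurable_fun setT (f t).
  by apply/measurable_EFinP; exact: (measurable_gain_pair _ _ _ bm).
have f0 t w l : Lam l -> 0 <= f t (w, l) by move=> Ll; rewrite lee_fin gain_ge0.
have key : \sum_(t < n) P (seqDU E t) * ((expR x0)%:E * area Lam) <= area Lam.
  apply: (@le_trans _ _
      (\sum_(t < n) \int[P]_(w in seqDU E t) \int[area]_(l in Lam) (gain l t w)%:E)).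
    apply: lee_sum => t _; rewrite muleC -integral_cst//.
    apply: ge0_le_integral => //.
    - by move=> w _; rewrite mule_ge0// lee_fin expR_ge0.
    - exact: (measurable_fun_integral_setXl area (mD t) mL (mf t) (f0 t)).
    - by move=> w [Ew _]; exact: mixture_gain_ge.
  have -> : \sum_(t < n) \int[P]_(w in seqDU E t) \int[area]_(l in Lam) (gain l t w)%:E =
      \sum_(t < n) \int[area]_(l in Lam) \int[P]_(w in seqDU E t) (gain l t w)%:E.
    apply: eq_bigr => t _.
    exact: (fubini_tonelli_setX P area (mD t) mL (mf t) (f0 t)).
  have mI t := measurable_fun_integral_setXr P (mD t) mL (mf t) (f0 t).
  have I0 t l : Lam l -> 0 <= \int[P]_(w in seqDU E t) (gain l t w)%:E.
    by move=> Ll; apply: integral_ge0 => w _; rewrite lee_fin gain_ge0.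
  rewrite -ge0_integral_sum//; last by move=> t l; exact: I0.
  apply: (@le_trans _ _ (\int[area]_(l in Lam) 1)); last first.
    by rewrite (integral_cst area mL 1) mul1e.
  apply: ge0_le_integral => //.
  - by move=> l Ll; apply: sume_ge0 => t _; exact: I0.
  - by apply: emeasurable_sum => t; exact: mI.
  - by move=> l Ll; apply: (sum_first_entrance_gain bm).
move: key; rewrite -ge0_sume_distrl; last by [].
have fs : \sum_(t < n) P (seqDU E t) \is a fin_num.
  by apply/sum_fin_numP => t _; rewrite fin_num_measure.
rewrite -(fineK fs) -(@fineK _ (area Lam)) ?ge0_fin_numE// -!EFinM !lee_fin.
have af : (0 < fine (area Lam))%R by rewrite fine_gt0// a0.
rewrite mulrA ger_pMl// expRN => H.
by rewrite -[leRHS]mul1r ler_pdivlMr ?expR_gt0.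
Qed.

Lemma deviation_bound_interior x0 :
  P (\bigcup_t deviation x0 t.+1) <= (expR (- x0))%:E.
Proof.
set E := fun t => deviation x0 t.+1.
have mE t : measurable (E t) by exact: (history_measurable bm (deviation_history _ _)).
have mD t : measurable (seqDU E t) by apply: measurableD => //; apply: bigsetU_measurable.
rewrite -/E seqDU_bigcup_eq measure_bigcup//.
apply: lime_le; first by apply: is_cvg_nneseries.
apply: nearW => n; rewrite big_mkord (eq_bigl predT); last by move=> i; rewrite in_setT.
exact: sum_first_deviation_le.
Qed.

End interior_mean.

(* At the boundary of the moment constraint the only feasible law is the Dirac
   mass at [B `^ p^-1]. *)
Section boundary_mean.
Hypothesis Bx : (B `^ p^-1 <= x)%R.
Local Notation r := (B `^ p^-1)%R.

(** If all observations equal [r], the law of the arm is feasible with zero divergence, and the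
    statistic is at most [-1 < x0]. An observation other than [r] has mass 0 under every feasible
    law, which makes [KLinf] infinite. *)
Lemma boundary_deviationP x0 n w : (0 <= x0)%R ->
  deviation x0 n w <-> exists2 y, y \in samples A Y b n w & y != r.
Proof.
move=> x00; rewrite /deviation/= -(size_samples A Y).
move: (samples A Y b n w) => s; split=> [[s0 H]|[y ys yr]].
  apply: contrapT => sr; move: H; apply/negP; rewrite -ltNge.
  have {}sr y : y \in s -> y = r.
    by move=> ys; apply/eqP/negPn/negP => yr; apply: sr; exists y.
  have mur : mu b [set r] = 1.
    rewrite -[X in mu b X]setCK probability_setC; last first.
      by apply: measurableC; exact: measurable_set1.
    by rewrite (boundary_law_dirac e0 B0 Bx mB (lexx _)) sube0.
  have count1 : count_mem r s = size s.
    by apply/eqP; rewrite -all_count; apply/allP => y /sr ->; exact: eqxx.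
  have n0 : (0 < (size s)%:R :> R)%R by rewrite ltr0n.
  have smu : empirical s `<< mu b.
    apply/null_content_dominatesP => C mC C0; apply: etrans (empiricalE C s0) _.
    rewrite (_ : count _ _ = 0%N) ?mul0r//.
    apply/eqP; rewrite -leqn0 leqNgt -has_count; apply/hasPn => y /sr ->.
    apply/asboolP => Cr; have : mu b [set r] <= mu b C.
      by apply: le_measure; rewrite ?inE// => _ ->.
    by rewrite [leRHS]C0 mur lee_fin ler10.
  apply: (@le_lt_trans _ _ ((size s)%:R%:E * KL (empirical s) (mu b) - 1
      - (2 * ln (1 + (size s)%:R))%R%:E)).
    apply: leeD => //; apply: leeD => //; apply: lee_wpmul2l; first by rewrite lee_fin.
    by apply: ereal_inf_lbound; exists (mu b).
  rewrite KL_empirical// big_seq big1 => [|y ys]; last first.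
    by rewrite (sr _ ys) mur count1 divff ?gt_eqF//= divr1 ln1.
  rewrite -!EFinB lte_fin.
  have : (0 <= ln (1 + (size s)%:R) :> R)%R by rewrite ln_ge0// lerDl.
  move: (ln _) x00 => L; lra.
have s0 : (0 < size s)%N by case: s ys.
split => //.
have -> : KLinf B eps (empirical s) x = +oo.
  apply/eqP; rewrite -leye_eq; apply: le_ereal_inf_tmp => _ [kappa [kB xk] <-].
  rewrite /KL; case: asboolP => // sk.
  have := empirical_dominates_set1 sk ys.
  have -> : kappa [set y] = 0.
    apply/eqP; rewrite eq_le measure_ge0 andbT.
    rewrite -(boundary_law_dirac e0 B0 Bx kB xk); apply: le_measure.
    - by rewrite inE; exact: measurable_set1.
    - by rewrite inE; apply: measurableC; exact: measurable_set1.
    - by move=> _ ->; exact/eqP.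
  by rewrite ltxx.
by rewrite gt0_muley ?lte_fin ?ltr0n//= leey.
Qed.

(** The event says that some pull of arm [b] gives a reward other than [r]: a countable union of
    null events. *)
Lemma deviation_bound_boundary x0 : (0 <= x0)%R ->
  P (\bigcup_t deviation x0 t.+1) = 0.
Proof.
move=> x00.
pose M s := A s.+1 @^-1` [set b] `&` Y s.+1 @^-1` (~` [set r]).
have mr : measurable (~` [set r] : set (measurableTypeR R)).
  by apply: measurableC; exact: measurable_set1.
have -> : \bigcup_t deviation x0 t.+1 = \bigcup_s M s.
  apply/seteqP; split => w [t _].
    move=> /(boundary_deviationP _ _ x00)[y /mapP[[|s]]].
      by rewrite mem_filter mem_index_iota andbF.
    rewrite mem_filter => /andP[/eqP As _] -> /eqP Ys; by exists s.
  move=> [/= At Yt]; exists t.+1 => //; apply/(boundary_deviationP _ _ x00).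
  exists (Y t.+1 w); last exact/eqP.
  by apply: map_f; rewrite mem_filter At eqxx mem_index_iota/= ltnSn.
have FA s : F s (A s.+1 @^-1` [set b]) by exact: (arm_predictable bm).
have mM s : measurable (M s).
  apply: measurableI; first exact: (history_measurable bm (FA s)).
  by apply: (history_measurable bm); apply: (reward_adapted bm).
apply: measure_negligible; first exact: bigcup_measurable.
apply: negligible_bigcup => s; exists (M s); split => //.
have FT : F s setT by rewrite -(historyE bm); exact: measurableT.
have := reward_law bm b FT mr.
by rewrite !setTI (boundary_law_dirac e0 B0 Bx mB (lexx _)) mule0.
Qed.

End boundary_mean.

Lemma deviation_bound x0 : (0 <= x0)%R ->
  P (\bigcup_t deviation x0 t.+1) <= (expR (- x0))%:E.
Proof.
move=> x00; have [xB|Bx] := ltP x (B `^ p^-1)%R; first exact: deviation_bound_interior.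
by rewrite deviation_bound_boundary// lee_fin expR_ge0.
Qed.

End deviation_bound.

(** * The deviation inequality along a run of the algorithm *)

Local Open Scope ereal_scope.

Theorem proposition5 (R : realType) (B eps : R) (K : nat)
    (mu : 'I_K -> borel_probability R)
    (d : measure_display) (Omega : measurableType d) (P : probability Omega R)
    (F : nat -> set (set Omega))
    (A : nat -> Omega -> 'I_K) (Y : nat -> Omega -> R)
    (etat : R) (g : 'I_K -> nat -> Omega -> R) :
  (0 < B)%R -> (0 < eps)%R -> (2 <= K)%N ->
  (forall a, moment_class B eps (mu a)) ->
  bandit_model P mu F A Y ->
  (0 <= etat)%R -> klucb_run B eps etat g A Y ->
  forall (x : R) (b : 'I_K), (0 <= x)%R ->
  P [set w | exists n : nat, (1 <= pulls A b n w)%N /\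
       (pulls A b n w)%:R%:E
         * KLinf B eps (empirical (samples A Y b n w)) (mean (mu b))
       - 1 - (2 * ln (1 + (pulls A b n w)%:R))%R%:E >= x%:E]
  <= (expR (- x))%:E.
Proof.
move=> B0 e0 _ mB bm _ _ x b x0.
rewrite [X in P X](_ : _ = \bigcup_t deviation mu A Y b B eps x t.+1).
  exact: (deviation_bound bm).
apply/seteqP; split => w; last by move=> [t _ Dw]; exists t.+1.
(* At [n = 0] there are no pulls, so the event requires [n] to be a successor. *)
by move=> [[|t] Dw]; [case: Dw; rewrite /pulls|exists t].
Qed.
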